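(* Let $\pi_0,\pi_1\in\mathcal P_{\mathcal X}$ with $\pi_1\ll\pi_0$, and let $T\ge1$ be an integer. Then there exists a Borel set $\Gamma^\star\subseteq\mathcal X^T$, viewed as an event on $\mathcal X^\infty$ depending only on the first $T$ observations, such that $\pi_0^\otimes(\Gamma^\star)\le\alpha$ and $$\sup_{U^\infty\text{ e-process}}\pi_1^\otimes\bigl(\tau^{U^\infty}\le T\bigr)=\pi_1^\otimes(\Gamma^\star)=\max\bigl\{\pi_1^\otimes(\Gamma):\Gamma\subseteq\mathcal X^T\text{ Borel},\ \pi_0^\otimes(\Gamma)\le\alpha\bigr\},$$ where the supremum is over all e-processes for the null $\pi_0^\otimes$. Moreover, fixing Borel versions of the conditional probabilities $x^t\mapsto\pi_0^\otimes(\Gamma^\star\mid x^t)$, the supremum is achieved by the $\pi_0^\otimes$-martingale $U_t^\star(x^t)=\pi_0^\otimes(\Gamma^\star\mid x^t)/\pi_0^\otimes(\Gamma^\star)$ if $\pi_0^\otimes(\Gamma^\star)>0$, and by the constant e-process $U_t\equiv1$ otherwise.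
   Context: $\mathcal X$ is a standard Borel space, $\mathcal P_{\mathcal X}$ is the set of Borel probability measures on $\mathcal X$; for $\pi\in\mathcal P_{\mathcal X}$, $\pi^\otimes$ is the infinite product measure on $\mathcal X^\infty$ (the law of an i.i.d. sequence $x_1,x_2,\dots$ with common law $\pi$). $x^t=(x_1,\dots,x_t)$, with $x^0$ the empty history. A level $\alpha\in(0,1)$ is fixed. $\mathbb R_+=[0,\infty)$ and $\inf\emptyset=\infty$. For a Borel set $\Gamma\subseteq\mathcal X^T$, $\pi^\otimes(\Gamma)$ means $\pi^\otimes(\{x^\infty:x^T\in\Gamma\})$, and $\pi_0^\otimes(\Gamma\mid x^t)$ is the conditional probability under $\pi_0^\otimes$ of this event given the first $t$ observations (equal to the indicator of $\Gamma$ almost surely for $t\ge T$). An e-process for $\pi_0^\otimes$ is a sequence $U^\infty=(U_t)_{t\ge0}$ of Borel maps $U_t:\mathcal X^t\to\mathbb R_+$ such that $\mathbb E_{\pi_0^\otimes}[U_\tau]\le1$ for every stopping time $\tau$ of the natural filtration of the observations (with $U_\infty:=\limsup_{t}U_t$ when $\tau$ may be infinite). Its rejection time is $\tau^{U^\infty}=\inf\{t\ge0:U_t\ge\alpha^{-1}\}$. *)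

(* Defs.v *)
From HB Require Import structures.
From mathcomp Require Import all_boot all_order all_algebra.
From mathcomp Require Import all_classical all_reals all_analysis.
From mathcomp Require Import measurable_realfun.
Set Implicit Arguments. Unset Strict Implicit. Unset Printing Implicit Defensive.
Import Order.TTheory GRing.Theory Num.Theory.
Import numFieldNormedType.Exports.
Local Open Scope classical_set_scope.
Local Open Scope ring_scope.
Local Open Scope ereal_scope.

(* Polish spaces are the separable, Hausdorff, complete pseudometric spaces. *)
Definition standard_borel (R : realType) d (X : measurableType d) : Prop :=
  exists (Y : completePseudoMetricType R) (f : X -> Y),
    [/\ hausdorff_space Y, exists2 D : set Y, countable D & dense D,
        bijective f &
        @measurable _ X = preimage_set_system setT f <<s @open Y >>].

Definition coordinate_sets d (X : measurableType d) : set (set (nat -> X)) :=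
  \bigcup_i preimage_set_system setT (fun x : nat -> X => x i) measurable.

(* [X^oo] with its product sigma-algebra; the observation [x_i] is [x i.-1]. *)
Notation pathspace X := (g_sigma_algebraType (@coordinate_sets _ X)).

(* Rectangles over finitely many coordinates form a pi-system generating the
   product sigma-algebra, so this determines [P]. *)
Definition is_iid_law (R : realType) d (X : measurableType d)
    (pi : probability X R) (P : probability (pathspace X) R) : Prop :=
  forall (n : nat) (A : nat -> set X), (forall i, measurable (A i)) ->
    P [set x | forall i, (i < n)%N -> A i (x i)] = \prod_(i < n) pi (A i).

(* Existence of the infinite product measure: a content on the algebra of
   cylinders is defined by iterated integration, shown to be sigma-additive, and
   extended; no topological assumption on [X] is used. *)
Section iid_law_construction.
Context {R : realType} {d} {X : measurableType d} (pi : probability X R).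
Local Notation Om := (pathspace X).
Implicit Types (f g : Om -> \bar R) (A B : set Om) (x : Om) (k m n p : nat).

Lemma measurable_coord i : measurable_fun [set: Om] (fun x : Om => x i).
Proof.
move=> _ B mB; apply: sub_sigma_algebra; exists i => //; exists B => //.
Qed.

Lemma measurable_to_path d' (S : measurableType d') (h : S -> Om) :
  (forall i, measurable_fun setT (fun s => h s i)) -> measurable_fun setT h.
Proof.
move=> mh; apply: (@measurability _ _ _ Om setT _ (@coordinate_sets _ X)) => //.
move=> _ [_ [i _ [B mB <-]] <-]; rewrite !setTI.
by have := mh i measurableT B mB; rewrite setTI.
Qed.

Definition path_upd x (k : nat) (y : X) : Om := fun i => if i == k then y else x i.

Lemma measurable_path_upd k :
  measurable_fun setT (fun p : Om * X => path_upd p.1 k p.2).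
Proof.
apply: measurable_to_path => i; rewrite /path_upd; case: eqP => _.
  exact: measurable_snd.
exact: (measurableT_comp (measurable_coord i) measurable_fst).
Qed.

Definition depends_on_first n (U : Type) (f : Om -> U) :=
  forall x y, (forall i, (i < n)%N -> x i = y i) -> f x = f y.

Definition mean_coord k f x := \int[pi]_y f (path_upd x k y).

Fixpoint mean_coords k m f : Om -> \bar R :=
  if m is m'.+1 then mean_coord k (mean_coords k.+1 m' f) else f.

Definition pos_meas f := measurable_fun [set: Om] f /\ forall x, 0 <= f x.

Lemma pos_meas_upd k f x : pos_meas f ->
  measurable_fun setT (fun y => f (path_upd x k y)).
Proof.
move=> [mf _].
exact: (measurableT_comp mf (measurable_fun_pair2 x (measurable_path_upd k))).
Qed.

Lemma pos_meas_mean k f : pos_meas f -> pos_meas (mean_coord k f).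
Proof.
move=> [mf f0]; split; last by move=> x; apply: integral_ge0.
apply: (measurable_fun_fubini_tonelli_F
   (fun p : Om * X => f (path_upd p.1 k p.2))).
  exact: (measurableT_comp mf (measurable_path_upd k)).
by move=> ?.
Qed.

Lemma pos_meas_means k m f : pos_meas f -> pos_meas (mean_coords k m f).
Proof. by elim: m k f => //= m IH k f pf; apply/pos_meas_mean/IH. Qed.

Lemma mean_coords_ge0 k m f x : (forall x, 0 <= f x) -> 0 <= mean_coords k m f x.
Proof.
move=> f0; elim: m k x => //= m IH k x; apply: integral_ge0 => *; exact: IH.
Qed.

Lemma mean_coordsD k m f g : pos_meas f -> pos_meas g ->
  mean_coords k m (f \+ g) = mean_coords k m f \+ mean_coords k m g.
Proof.
move=> pf pg; elim: m k => //= m IH k; rewrite IH; apply/funext => x /=.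
have pf' := pos_meas_means k.+1 m pf; have pg' := pos_meas_means k.+1 m pg.
rewrite /mean_coord /= ge0_integralD//.
- by move=> y _; apply: pf'.2.
- exact: pos_meas_upd.
- by move=> y _; apply: pg'.2.
- exact: pos_meas_upd.
Qed.

Lemma mean_coordsZ k m f (r : \bar R) : pos_meas f -> 0 <= r ->
  mean_coords k m (fun x => r * f x) = (fun x => r * mean_coords k m f x).
Proof.
move=> pf r0; elim: m k => //= m IH k; rewrite IH; apply/funext => x /=.
have pf' := pos_meas_means k.+1 m pf.
rewrite /mean_coord /= ge0_integralZl//.
- exact: pos_meas_upd.
- by move=> y _; apply: pf'.2.
Qed.

Lemma le_mean_coords k m f g : pos_meas f -> pos_meas g ->
  (forall x, f x <= g x) -> forall x, mean_coords k m f x <= mean_coords k m g x.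
Proof.
move=> pf pg fg; elim: m k => //= m IH k x.
have pf' := pos_meas_means k.+1 m pf; have pg' := pos_meas_means k.+1 m pg.
apply: ge0_le_integral => //.
- by move=> y _; apply: pf'.2.
- exact: pos_meas_upd.
- exact: pos_meas_upd.
Qed.

Lemma mean_coord_id n k f : depends_on_first n f -> (n <= k)%N ->
  mean_coord k f = f.
Proof.
move=> df nk; apply/funext => x; rewrite /mean_coord.
rewrite (eq_integral (cst (f x))); last first.
  move=> y _; apply: df => i il; rewrite /path_upd; case: eqP => // ik.
  by move: il; rewrite ik ltnNge nk.
by rewrite integral_cst// [X in _ * X]probability_setT mule1.
Qed.

Lemma mean_coords_id n k m f : depends_on_first n f -> (n <= k)%N ->
  mean_coords k m f = f.
Proof.
move=> df; elim: m k => //= m IH k nk.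
by rewrite IH ?(leqW nk)// (mean_coord_id df).
Qed.

Lemma mean_coords_add k m p f :
  mean_coords k (m + p)%N f = mean_coords k m (mean_coords (k + m)%N p f).
Proof. by elim: m k => [|m IH] k; rewrite ?addn0//= IH addSnnS. Qed.

Lemma mean_coords_dim n k m f : depends_on_first n f -> (n <= k + m)%N ->
  mean_coords k m f = mean_coords k (n - k)%N f.
Proof.
move=> df nkm; have -> : m = ((n - k) + (m - (n - k)))%N.
  by rewrite subnKC// leq_subLR.
by rewrite mean_coords_add (mean_coords_id _ df)// -leq_subLR.
Qed.

Lemma dep_mean k f : depends_on_first k.+1 f -> depends_on_first k (mean_coord k f).
Proof.
move=> df x y xy; apply: eq_integral => z _; apply: df => i.
rewrite /path_upd; case: eqP => // /eqP ik; rewrite ltnS leq_eqVlt (negbTE ik).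
exact: xy.
Qed.

Lemma dep_le n m (U : Type) (f : Om -> U) : (n <= m)%N ->
  depends_on_first n f -> depends_on_first m f.
Proof. by move=> nm df x y xy; apply: df => i il; apply: xy (leq_trans il nm). Qed.

Lemma dep_means k m f : depends_on_first (k + m)%N f ->
  depends_on_first k (mean_coords k m f).
Proof.
elim: m k f => [|m IH] k f; first by rewrite addn0.
by move=> df; apply: dep_mean; apply: IH; rewrite addSnnS.
Qed.

Definition cylinder A := measurable A /\ exists n, depends_on_first n A.
Definition cyl_dim A := xget 0%N [set n | depends_on_first n A].
Definition ind A : Om -> \bar R := fun x => (\1_A x)%:E.

Lemma dep_ind n A : depends_on_first n A -> depends_on_first n (ind A).
Proof.
move=> dA x y xy; rewrite /ind !indicE; congr ((nat_of_bool _)%:R%:E).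
by rewrite /in_mem/= /in_set; congr asbool; apply: dA.
Qed.

Lemma pos_meas_ind A : measurable A -> pos_meas (ind A).
Proof.
move=> mA; split; first exact/measurable_EFinP/measurable_indic.
by move=> x; rewrite lee_fin.
Qed.

(* For a cylinder [A]: the content of [A] given the first [k] coordinates,
   obtained by integrating out the later ones. *)
Definition cyl_cond k A := mean_coords k (cyl_dim A - k)%N (ind A).

Lemma cyl_dimP A : cylinder A -> depends_on_first (cyl_dim A) A.
Proof.
by move=> [_ [n dA]]; rewrite /cyl_dim; apply: (@xgetPex _ 0%N
  [set n | depends_on_first n A]); exists n.
Qed.

Lemma cyl_condE n k m A : depends_on_first n A -> (n <= k + m)%N ->
  cylinder A -> cyl_cond k A = mean_coords k m (ind A).
Proof.
move=> dA nkm /cyl_dimP/dep_ind dA'; move/dep_ind in dA.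
rewrite /cyl_cond -(@mean_coords_dim _ _ (m + (cyl_dim A - k))%N _ dA'); last first.
  by rewrite addnCA (leq_trans _ (leq_addl _ _))// -leq_subLR.
rewrite (mean_coords_dim dA) ?(mean_coords_dim dA nkm)//.
by rewrite addnA (leq_trans nkm)// leq_addr.
Qed.

Lemma pos_meas_cond k A : cylinder A -> pos_meas (cyl_cond k A).
Proof. by move=> [mA _]; apply: pos_meas_means; apply: pos_meas_ind. Qed.

Lemma cyl_cond_step k A : cylinder A ->
  cyl_cond k A = mean_coord k (cyl_cond k.+1 A).
Proof.
move=> cA; have dA := cyl_dimP cA.
rewrite (@cyl_condE (cyl_dim A) k (cyl_dim A).+1 A)//; last first.
  by rewrite addnS leqW// leq_addl.
by rewrite /= -(@cyl_condE (cyl_dim A))// leq_addl.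
Qed.

Lemma dep_cond k A : cylinder A -> depends_on_first k (cyl_cond k A).
Proof.
move=> cA; have dA := cyl_dimP cA; apply: dep_means; apply: dep_ind.
by apply: dep_le dA; rewrite -leq_subLR.
Qed.

Lemma cyl_cond_full k A : cylinder A -> (cyl_dim A <= k)%N -> cyl_cond k A = ind A.
Proof. by move=> cA; rewrite /cyl_cond -subn_eq0 => /eqP ->. Qed.

Lemma dep_set0 : depends_on_first 0 (@set0 Om). Proof. by []. Qed.

Lemma cylinderU A B : cylinder A -> cylinder B -> cylinder (A `|` B).
Proof.
move=> [mA [n dA]] [mB [m dB]]; split; first exact: measurableU.
exists (maxn n m) => x y xy; rewrite /setU /mkset.
by rewrite (dep_le (leq_maxl n m) dA xy) (dep_le (leq_maxr n m) dB xy).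
Qed.

Lemma cylinderC A : cylinder A -> cylinder (~` A).
Proof.
move=> [mA [n dA]]; split; first exact: measurableC.
by exists n => x y xy; rewrite /setC /mkset (dA _ _ xy).
Qed.

Lemma cylinder0 : cylinder set0. Proof. by split => //; exists 0%N. Qed.

Definition cyltype : Type := Om.
Definition cyldisplay : measure_display. Proof. exact: default_measure_display. Qed.
HB.instance Definition _ := Pointed.on cyltype.
HB.instance Definition _ := @isAlgebraOfSets.Build cyldisplay cyltype
  cylinder cylinder0 cylinderU cylinderC.

Lemma cyl_condU k A B : cylinder A -> cylinder B -> A `&` B = set0 ->
  cyl_cond k (A `|` B) = cyl_cond k A \+ cyl_cond k B.
Proof.
move=> cA cB AB; have cU := cylinderU cA cB.
pose m := (cyl_dim A + cyl_dim B + cyl_dim (A `|` B))%N.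
have dA := cyl_dimP cA; have dB := cyl_dimP cB; have dU := cyl_dimP cU.
rewrite (@cyl_condE _ k m A dA)//; last by rewrite /m -!addnA addnCA leq_addr.
rewrite (@cyl_condE _ k m B dB)//; last by rewrite /m -addnA 2!addnA addnAC leq_addl.
rewrite (@cyl_condE _ k m _ dU)//; last by rewrite /m addnA leq_addl.
have [? _] := cA; have [? _] := cB.
rewrite -mean_coordsD; [|exact: pos_meas_ind|exact: pos_meas_ind].
congr (mean_coords _ _ _); apply/funext => x; rewrite /ind /=.
rewrite (_ : \1_(A `|` B) x = \1_A x + \1_B x)%R ?EFinD//.
rewrite !indicE in_setU; case: (boolP (x \in A)); case: (boolP (x \in B)) => //=;
  rewrite ?addr0 ?add0r// => /set_mem Bx /set_mem Ax.
by have : (A `&` B) x by []; rewrite AB.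
Qed.

Lemma cyl_cond_le k A B : cylinder A -> cylinder B -> A `<=` B ->
  forall x, cyl_cond k A x <= cyl_cond k B x.
Proof.
move=> cA cB AB x.
pose m := (cyl_dim A + cyl_dim B)%N.
have dA := cyl_dimP cA; have dB := cyl_dimP cB.
rewrite (@cyl_condE _ k m A dA)//; last by rewrite /m addnCA leq_addr.
rewrite (@cyl_condE _ k m B dB)//; last by rewrite /m addnA leq_addl.
apply: le_mean_coords => [||y]; [exact: pos_meas_ind cA.1|exact: pos_meas_ind cB.1|].
rewrite /ind lee_fin !indicE ler_nat; case: (boolP (y \in A)) => // /set_mem /AB By.
by rewrite mem_set.
Qed.

Lemma cyl_condT k x : cyl_cond k setT x = 1.
Proof.
have dT : depends_on_first 0 [set: Om] by [].
have cT : cylinder setT by split=> //; exists 0%N.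
by rewrite (@cyl_condE 0 k 0 setT)//= /ind indicT.
Qed.

Lemma cyl_cond_le1 k A x : cylinder A -> cyl_cond k A x <= 1.
Proof.
by move=> cA; rewrite -(cyl_condT k x); apply: cyl_cond_le => //; split=> //; exists 0%N.
Qed.

Lemma cyl_cond_cvg0_step k x (F : nat -> set Om) : (forall n, cylinder (F n)) ->
  (forall y, cyl_cond k.+1 (F n) (path_upd x k y) @[n --> \oo] --> 0) ->
  cyl_cond k (F n) x @[n --> \oo] --> 0.
Proof.
move=> cF F0.
have [] := @dominated_convergence _ X R pi setT measurableT
  (fun n y => cyl_cond k.+1 (F n) (path_upd x k y)) (cst 0) (cst 1).
- by move=> n; apply: pos_meas_upd; exact: pos_meas_cond.
- by [].
- by apply/aeW => y _; exact: F0.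
- exact: finite_measure_integrable_cst.
- apply/aeW => y n _ /=; rewrite gee0_abs; first exact: cyl_cond_le1.
  exact: (pos_meas_cond _ (cF n)).2.
move=> _ _; rewrite integral0 => H.
rewrite (_ : (fun n => _) = fun n => mean_coord k (cyl_cond k.+1 (F n)) x)//.
by apply/funext => n; rewrite cyl_cond_step.
Qed.

Lemma cyl_cond_cvg0 (F : nat -> set Om) : (forall n, cylinder (F n)) ->
  (forall n m, (n <= m)%N -> F m `<=` F n) -> \bigcap_n F n = set0 ->
  cyl_cond 0 (F n) point @[n --> \oo] --> 0.
Proof.
move=> cF dF F0; apply: contrapT => N0.
pose NZ k x := ~ (cyl_cond k (F n) x @[n --> \oo] --> 0).
have step k x : exists y, NZ k x -> NZ k.+1 (path_upd x k y).
  apply: contrapT => /forallNP H.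
  have NZx : NZ k x by apply: contrapT => nNZ; apply: (H point).
  apply: NZx; apply: cyl_cond_cvg0_step => // y; apply: contrapT => Hy.
  by apply: (H y).
pose nxt k x := projT1 (cid (step k x)).
pose s := fix s k : Om := if k is k'.+1 then path_upd (s k') k' (nxt k' (s k')) else point.
have NZs k : NZ k (s k).
  by elim: k => // k IH; apply: (projT2 (cid (step k (s k)))).
pose z : Om := fun i => s i.+1 i.
have sz k i : (i < k)%N -> s k i = z i.
  elim: k => // k IH; rewrite ltnS leq_eqVlt => /predU1P[->//|ik].
  by rewrite /= /path_upd (ltn_eqF ik) IH.
have [n Fnz] : exists n, ~ F n z.
  apply: contrapT => /forallNP H; suff : (\bigcap_n F n) z by rewrite F0.
  by move=> n _; apply: contrapT => /H.
apply: (NZs (cyl_dim (F n))).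
apply: cvg_near_cst; near=> m.
have nm : (n <= m)%N by near: m; exists n.
apply/eqP; rewrite eq_le (pos_meas_cond _ (cF m)).2 andbT.
apply: le_trans (cyl_cond_le _ (cF m) (cF n) (dF _ _ nm) _) _.
rewrite cyl_cond_full// (dep_ind (cyl_dimP (cF n)) (sz _)).
by rewrite /ind indicE memNset.
Unshelve. all: by end_near. Qed.

Definition cyl_measure (A : set cyltype) : \bar R := cyl_cond 0 A point.

Let cyl_measure0 : cyl_measure set0 = 0.
Proof.
rewrite /cyl_measure (@cyl_condE 0 0 0 set0 dep_set0)//; last exact: cylinder0.
by rewrite /= /ind indic0.
Qed.

Let cyl_measure_ge0 A : 0 <= cyl_measure A.
Proof. by apply: mean_coords_ge0 => x; rewrite lee_fin. Qed.

Let cyl_measure_sigma_additive : semi_sigma_additive cyl_measure.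
Proof.
move=> F mF tF mU; set U := \bigcup_n F n.
pose S n : set cyltype := \big[setU/set0]_(i < n) F i.
have mS n : measurable (S n) by exact: bigsetU_measurable.
have SU n : S n `<=` U.
  by rewrite /S -bigcup_mkord; apply: bigcup_sub => i _; exact: bigcup_sup.
have mR n : measurable (U `\` S n) by exact: measurableD.
have split n : cyl_measure U = cyl_measure (S n) + cyl_measure (U `\` S n).
  rewrite -[in LHS](setDUK (SU n)) /cyl_measure cyl_condU//;
    [exact: mS|exact: mR|].
  by rewrite setDE setICA setICr setI0.
have sumS n : cyl_measure (S n) = \sum_(i < n) cyl_measure (F i).
  elim: n => [|n IH]; first by rewrite /S !big_ord0.
  rewrite /S !big_ord_recr/= -IH /cyl_measure cyl_condU//; [exact: mS|exact: mF|].
  rewrite -bigcup_mkord setI_bigcupl; apply: bigcup0 => i /= ilt.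
  apply: contrapT => /eqP/set0P H; have := tF i n I I H.
  by move=> E; rewrite E ltnn in ilt.
have fin (A : set cyltype) : measurable A -> cyl_measure A \is a fin_num.
  move=> mA; rewrite ge0_fin_numE//; apply: (@le_lt_trans _ _ 1); last exact: ltry.
  exact: cyl_cond_le1.
have R0 : cyl_measure (U `\` S n) @[n --> \oo] --> 0.
  apply: (@cyl_cond_cvg0 (fun n => U `\` S n)) => //.
    move=> n m nm; apply: setDS; rewrite /S -!bigcup_mkord.
    by apply: bigcup_sub => i /= il; apply: bigcup_sup; exact: leq_trans nm.
  rewrite -subset0 => x H; have [[i _ Fix] _] := H 0%N I.
  have [_] := H i.+1 I; apply; rewrite /S -bigcup_mkord; exists i => //=.
rewrite -[X in _ --> X]sube0.
rewrite (_ : (fun _ => _) = (fun n => cyl_measure U - cyl_measure (U `\` S n))).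
  by apply: cvgeB => //; [exact: fin_num_adde_defl|exact: cvg_cst].
apply/funext => n; rewrite (split n) addeK ?fin//.
by rewrite sumS big_mkord.
Qed.

HB.instance Definition _ := isMeasure.Build _ _ _ cyl_measure
  cyl_measure0 cyl_measure_ge0 cyl_measure_sigma_additive.

Let iid_ext : {measure set (g_sigma_algebraType (@measurable _ cyltype)) -> \bar R} :=
  measure_extension cyl_measure.

Lemma measurable_ext_id : measurable_fun setT
  (fun x : g_sigma_algebraType (@measurable _ cyltype) => x : Om).
Proof.
apply: (@measurability _ _ _ Om setT _ (@coordinate_sets _ X)) => //.
move=> _ [_ [i _ [B mB <-]] <-]; rewrite !setTI.
apply: sub_sigma_algebra; split.
  by have := measurable_coord i measurableT mB; rewrite setTI.
by exists i.+1 => x y xy; rewrite /preimage /mkset xy.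
Qed.

Let measurable_ext (A : set Om) : measurable A ->
  measurable (A : set (g_sigma_algebraType (@measurable _ cyltype))).
Proof. by move=> mA; have := measurable_ext_id measurableT mA; rewrite setTI. Qed.

Definition iid_measure (A : set Om) : \bar R := iid_ext A.

Let iid_measure0 : iid_measure set0 = 0. Proof. exact: measure0. Qed.

Let iid_measure_ge0 A : 0 <= iid_measure A. Proof. exact: measure_ge0. Qed.

Let iid_measure_sigma_additive : semi_sigma_additive iid_measure.
Proof.
move=> F mF tF mU; apply: (@measure_semi_sigma_additive _ _ _ iid_ext) => //.
  by move=> i; exact: measurable_ext.
exact: measurable_ext.
Qed.

HB.instance Definition _ := isMeasure.Build _ _ _ iid_measure
  iid_measure0 iid_measure_ge0 iid_measure_sigma_additive.

Let iid_measure_cyl A : cylinder A -> iid_measure A = cyl_cond 0 A point.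
Proof. by move=> cA; rewrite /iid_measure/= /measure_extension measurable_mu_extE. Qed.

Let iid_measureT : iid_measure setT = 1.
Proof.
have cT : cylinder setT by split=> //; exists 0%N.
by rewrite (iid_measure_cyl cT) cyl_condT.
Qed.

HB.instance Definition _ := Measure_isProbability.Build _ _ _ iid_measure iid_measureT.

Lemma iid_law_exists : exists P : probability Om R, is_iid_law pi P.
Proof.
exists iid_measure => n A mA /=.
pose S m : set Om := [set x | forall i, (i < m)%N -> A i (x i)].
have dS m : depends_on_first m (S m).
  move=> x y xy; apply/propext; split => H i im; first by rewrite -xy//; exact: H.
  by rewrite xy//; exact: H.
have SE m : S m.+1 = S m `&` (fun x : Om => x m) @^-1` A m.
  apply/seteqP; split => [x H|x [H1 H2] i].
    by split; [move=> i im; apply: H; exact: leqW|exact: H].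
  by rewrite ltnS leq_eqVlt => /predU1P[->//|]; exact: H1.
have mS m : measurable (S m).
  elim: m => [|m IH]; first by rewrite (_ : S 0%N = setT)//; apply/seteqP; split.
  rewrite SE; apply: measurableI => //.
  by have := measurable_coord m measurableT (mA m); rewrite setTI.
have cS m : cylinder (S m) by split; [|exists m].
rewrite iid_measure_cyl; last exact: cS.
rewrite (@cyl_condE n 0 n _ (dS n) (leqnn _) (cS n)).
suff H m x : mean_coords 0 m (ind (S m)) x = \prod_(i < m) pi (A i) by exact: H.
elim: m x => [|m IH] x.
  by rewrite big_ord0 /= /ind indicE mem_set.
rewrite -addn1 mean_coords_add /= add0n.
rewrite (_ : mean_coord m _ = fun x => pi (A m) * ind (S m) x); last first.
  apply/funext => y; rewrite /mean_coord.
  rewrite (eq_integral (fun z => ind (S m) y * (\1_(A m) z)%:E)); last first.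
    move=> z _; rewrite addn1 SE /ind -EFinM indicI /=; congr ((_ * _)%:E).
      rewrite !indicE; congr ((nat_of_bool _)%:R); rewrite /in_mem/= /in_set.
      congr asbool; apply: dS => i im.
      by rewrite /path_upd (ltn_eqF im).
    by rewrite !indicE /in_mem/= /in_set /preimage/= /path_upd eqxx.
  rewrite ge0_integralZl//; last 2 first.
  - exact/measurable_EFinP/measurable_indic.
  - by rewrite lee_fin.
  by rewrite integral_indic// setIT muleC.
rewrite mean_coordsZ//; last exact: pos_meas_ind.
by rewrite IH addn1 big_ord_recr/= muleC.
Qed.

End iid_law_construction.

Definition iid_law (R : realType) d (X : measurableType d) (pi : probability X R)
  : probability (pathspace X) R := projT1 (cid (iid_law_exists pi)).

Lemma iid_lawP (R : realType) d (X : measurableType d) (pi : probability X R) :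
  is_iid_law pi (iid_law pi).
Proof. exact: (projT2 (cid (iid_law_exists pi))). Qed.

Section sequential_testing.
Context {R : realType} {d} {X : measurableType d}.
Implicit Types (P : probability (pathspace X) R) (tau : pathspace X -> option nat).

Definition history t (x : pathspace X) : t.-tuple X := [tuple x i | i < t].

Definition cyl t (B : set (t.-tuple X)) : set (pathspace X) := history t @^-1` B.

(* [option nat] stands for the extended naturals, [None] being infinity. *)
Definition time_le (s : option nat) (t : nat) : bool :=
  if s is Some n then (n <= t)%N else false.

Definition stopping_time tau : Prop :=
  forall t, g_sigma_algebra_preimage (@history t) [set x | time_le (tau x) t].

Definition stopped (U : forall t, t.-tuple X -> R) tau (x : pathspace X) : \bar R :=
  if tau x is Some t then (U t (history t x))%:E
  else limn_esup (fun t => (U t (history t x))%:E).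

Definition e_process P (U : forall t, t.-tuple X -> R) : Prop :=
  [/\ forall t, measurable_fun setT (U t),
      forall t (h : t.-tuple X), (0 <= U t h)%R &
      forall tau, stopping_time tau -> \int[P]_x stopped U tau x <= 1].

(* The infimum of a set of times; [None] when the set is empty. *)
Definition first_time (S : set nat) : option nat :=
  xget None (Some @` [set n | S n /\ forall m, S m -> (n <= m)%N]).

Definition rejection_time (alpha : R) (U : forall t, t.-tuple X -> R)
    (x : pathspace X) : option nat :=
  first_time [set t | (alpha^-1 <= U t (history t x))%R].

Definition rejected_by (alpha : R) (U : forall t, t.-tuple X -> R) (T : nat) :
    set (pathspace X) := [set x | time_le (rejection_time alpha U x) T].

(* [g] is a Borel version of the conditional expectation [E_P[Y | x^t]]. *)
Definition is_cond_expectation P t (Y : pathspace X -> R) (g : t.-tuple X -> R) :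
    Prop :=
  [/\ measurable_fun setT g,
      P.-integrable setT (fun x => (g (history t x))%:E) &
      forall B : set (t.-tuple X), measurable B ->
        \int[P]_(x in cyl B) (g (history t x))%:E = \int[P]_(x in cyl B) (Y x)%:E].

(* Versions take values in [0, oo), so that they yield maps into R_+. *)
Definition is_cond_probability P (A : set (pathspace X)) t (q : t.-tuple X -> R) :
    Prop :=
  is_cond_expectation P (\1_A) q /\ forall h, (0 <= q h)%R.

Definition martingale P (U : forall t, t.-tuple X -> R) : Prop :=
  [/\ forall t, measurable_fun setT (U t),
      forall t, P.-integrable setT (fun x => (U t (history t x))%:E) &
      forall t, is_cond_expectation P (fun x => U t.+1 (history t.+1 x)) (U t)].

End sequential_testing.

Definition is_maximum (R : realType) (S : set (\bar R)) (m : \bar R) : Prop :=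
  S m /\ ubound S m.

(* Main.v *)
From HB Require Import structures.
Require Import Defs.
From mathcomp Require Import all_boot all_order all_algebra.
From mathcomp Require Import all_classical all_reals all_analysis.
From mathcomp Require Import measurable_realfun.
From mathcomp Require Import lra.
Set Implicit Arguments. Unset Strict Implicit. Unset Printing Implicit Defensive.
Import Order.TTheory GRing.Theory Num.Theory.
Import numFieldNormedType.Exports.
Local Open Scope classical_set_scope.
Local Open Scope ring_scope.
Local Open Scope ereal_scope.

(* Markov's inequality at the rejection time truncated at T gives every e-process
   null rejection probability at most alpha by time T, and the rejection event
   depends on the first T observations only; so the power of an e-process is
   bounded by the best power of a level-alpha region G in X^T. Conversely the
   martingale P0(G | x^t) / P0(G) equals 1_G / P0(G) from time T on, hence crosses
   1 / alpha on G, P0-almost surely and therefore P1-almost surely: the laws of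
   the first T observations inherit absolute continuity by Fubini.
   A best G exists without randomization: the atoms of P0 on X^T are countably many
   points, each kept or dropped without lowering the supremum, and on the atomless
   remainder likelihood-ratio regions realize every level exactly. Standard Borelness of X enters only through a
   countable family of measurable sets separating points. *)

(** * Real-valued probabilities and sets of prescribed mass *)

Section real_probability.
Context d (T : measurableType d) (R : realType).
Implicit Types (P : probability T R) (A B : set T).

Definition pr P A : R := fine (P A).

Lemma prE P A : measurable A -> P A = (pr P A)%:E.
Proof. by move=> mA; rewrite /pr fineK// fin_num_measure. Qed.

Lemma pr_ge0 P A : (0 <= pr P A)%R.
Proof. exact: fine_ge0. Qed.

Lemma pr_le1 P A : measurable A -> (pr P A <= 1)%R.
Proof. by move=> mA; rewrite -lee_fin -prE// probability_le1. Qed.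

Lemma pr_le P A B : measurable A -> measurable B -> A `<=` B ->
  (pr P A <= pr P B)%R.
Proof. by move=> mA mB AB; rewrite -lee_fin -!prE//; apply: le_measure; rewrite ?inE. Qed.

Lemma prID P A B : measurable A -> measurable B ->
  (pr P A = pr P (A `&` B) + pr P (A `\` B))%R.
Proof.
move=> mA mB; apply: EFin_inj; rewrite EFinD -!prE//.
- by rewrite addeC -measureDI.
- exact: measurableD.
- exact: measurableI.
Qed.

Lemma prU P A B : measurable A -> measurable B ->
  (pr P (A `|` B) <= pr P A + pr P B)%R.
Proof.
move=> mA mB; rewrite (@prID P (A `|` B) A)//; last exact: measurableU.
rewrite (setIidr (@subsetUl _ _ _)) lerD2l; apply: pr_le => //.
  by apply: measurableD => //; exact: measurableU.
by move=> x [[]].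
Qed.

Lemma prU_disj P A B : measurable A -> measurable B -> A `&` B = set0 ->
  (pr P (A `|` B) = pr P A + pr P B)%R.
Proof.
move=> mA mB AB; apply: EFin_inj; rewrite EFinD -!prE//; last exact: measurableU.
exact: measureU.
Qed.


Lemma pr_cvg_bigcap P (F : nat -> set T) : (forall n, measurable (F n)) ->
  (forall n, F n.+1 `<=` F n) ->
  pr P (F n) @[n --> \oo] --> pr P (\bigcap_n F n).
Proof.
move=> mF dF; apply: fine_cvg; rewrite fineK; last first.
  by rewrite fin_num_measure//; exact: bigcapT_measurable.
apply: nonincreasing_cvg_mu => //.
- by rewrite ltey_eq fin_num_measure.
- exact: bigcapT_measurable.
- by apply/nonincreasing_seqP => n; exact/subsetPset.
Qed.

Lemma pr_cvg_bigcup P (F : nat -> set T) : (forall n, measurable (F n)) ->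
  (forall n, F n `<=` F n.+1) ->
  pr P (F n) @[n --> \oo] --> pr P (\bigcup_n F n).
Proof.
move=> mF dF; apply: fine_cvg; rewrite fineK; last first.
  by rewrite fin_num_measure//; exact: bigcupT_measurable.
apply: nondecreasing_cvg_mu => //; first exact: bigcupT_measurable.
by apply/nondecreasing_seqP => n; exact/subsetPset.
Qed.

Lemma pr_vanish P (F : nat -> set T) (e : R) : (forall n, measurable (F n)) ->
  (forall n, F n.+1 `<=` F n) -> P (\bigcap_n F n) = 0 -> (0 < e)%R ->
  \forall n \near \oo, (pr P (F n) < e)%R.
Proof.
move=> mF dF F0 e0; have := @pr_cvg_bigcap P F mF dF.
by rewrite {2}/pr F0 => /cvgr_lt; exact.
Qed.

Definition separating (U : nat -> set T) :=
  forall x y, (forall n, U n x <-> U n y) -> x = y.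

(** The point is the intersection over [n] of whichever of [U n] and its complement contains it. *)
Lemma separating_measurable1 (U : nat -> set T) (x : T) : separating U ->
  (forall n, measurable (U n)) -> measurable [set x].
Proof.
move=> sU mU; pose V n := if `[< U n x >] then U n else ~` U n.
rewrite (_ : [set x] = \bigcap_n V n).
  by apply: bigcapT_measurable => n; rewrite /V; case: ifP => // _; exact: measurableC.
apply/seteqP; split => [_ -> n _|y Vy]; first by rewrite /V; case: asboolP.
by apply: sU => n; have := Vy n I; rewrite /V; case: asboolP.
Qed.

(* Bisection: at stage [n] the set [U n] cuts the gap between the current lower
   and upper sets; separation shrinks the gap to at most one point. *)
Lemma pr_intermediate P (U : nat -> set T) (L H : set T) (t : R) :
  separating U -> (forall n, measurable (U n)) ->
  measurable L -> measurable H -> L `<=` H ->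
  (forall x, (H `\` L) x -> P [set x] = 0) ->
  (pr P L <= t <= pr P H)%R ->
  exists G, [/\ measurable G, L `<=` G, G `<=` H & pr P G = t].
Proof.
move=> sU mU mL mH LH at0 /andP[Lt tH].
(* The cut adds to the lower set the part of the upper set in [U n]. It becomes the new upper set if
   its mass reaches [t], else the new lower set, so the two masses always bracket [t]. *)
pose mid n (s : set T * set T) := s.1 `|` (s.2 `&` U n).
pose step n (s : set T * set T) :=
  if (t <= pr P (mid n s))%R then (s.1, mid n s) else (mid n s, s.2).
pose s := fix s n := if n is n'.+1 then step n' (s n') else (L, H).
have inv n : [/\ measurable (s n).1 /\ measurable (s n).2, L `<=` (s n).1,
    (s n).1 `<=` (s n).2, (s n).2 `<=` H &
    (pr P (s n).1 <= t <= pr P (s n).2)%R].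
  elim: n => [|n]; first by split => //=; apply/andP.
  rewrite /= /step; set l := (s n).1; set h := (s n).2 => -[[ml mh] Ll lh hH /andP[lt th]].
  have mm : measurable (mid n (s n)) by apply: measurableU => //; exact: measurableI.
  case: ifPn => /= [tm|].
    split => //; [by move=> x lx; left| |by rewrite lt tm].
    by move=> x [/lh/hH//|[/hH]].
  rewrite -ltNge => /ltW mt; split => //; [|by move=> x [/lh|[]]|by rewrite mt th].
  by move=> x Lx; left; exact: Ll.
have lS n : (s n).1 `<=` (s n.+1).1.
  by rewrite /= /step; case: ifP => _ x //= ?; left.
have hS n : (s n.+1).2 `<=` (s n).2.
  have [_ _ lh _ _] := inv n.
  by rewrite /= /step; case: ifP => _ x //= [/lh|[]].
(* The outcome of comparison [n] alone decides on which side of [U n] the surviving gap lies, so all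
   its points agree on [U n]. *)
have sep n x : ((s n.+1).2 `\` (s n.+1).1) x -> (U n x <-> t <= pr P (mid n (s n)))%R.
  rewrite /= /step; case: ifPn => tm /= [] H1 H2; split => //.
    by case: H1 => [/H2//|[]].
  by move=> Ux; exfalso; apply: H2; right.
pose G := \bigcup_n (s n).1.
have mG : measurable G by apply: bigcupT_measurable => n; have [[]] := inv n.
have hlo m n : (m <= n)%N -> (s m).1 `<=` (s n).1.
  by move=> /subnK <-; elim: (n - m)%N => // k IH; apply: subset_trans IH (lS _).
have hhi m n : (m <= n)%N -> (s n).2 `<=` (s m).2.
  by move=> /subnK <-; elim: (n - m)%N => // k IH; apply: subset_trans (hS _) IH.
have Gh n : G `<=` (s n).2.
  move=> x [m _ mx]; have [_ _ lh _ _] := inv (maxn m n).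
  apply: (hhi n (maxn m n)) (leq_maxr _ _) _ _; apply: lh.
  exact: (hlo m _ (leq_maxl _ _)).
have LG : L `<=` G by move=> x Lx; exists 0%N.
have GH : G `<=` H by move=> x [n _ nx]; have [_ _ lh hH _] := inv n; exact/hH/lh.
exists G; split => //.
pose F n := (s n).2 `\` (s n).1.
have mF n : measurable (F n) by have [[? ?] _ _ _ _] := inv n; exact: measurableD.
have FS n : F n.+1 `<=` F n by move=> x [/hS ? H2]; split=> // /lS.
(* Points common to all gaps agree on every [U n], so there is at most one, and it is null because
   it lies in [H] outside [L]. *)
have F0 : P (\bigcap_n F n) = 0.
  have [[x Fx]|/forallNP F0] := pselect (exists x, (\bigcap_n F n) x); last first.
    by rewrite (_ : bigcap _ _ = set0) ?measure0// -subset0 => x /F0.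
  rewrite (_ : bigcap _ _ = [set x]); first by apply: at0; exact: (Fx 0%N I).
  apply/seteqP; split => [y Fy|_ -> //].
  apply: sU => n; have := Fx n.+1 I; have := Fy n.+1 I.
  by move=> /sep -> /sep ->.
(* Both [pr P G] and [t] lie between the masses of the lower and upper sets, whose difference is the
   mass of the gap. *)
have close n : (`|pr P G - t| <= pr P (F n))%R.
  have [[ml mh] Ll lh hH /andP[lt th]] := inv n.
  have lG : (pr P (s n).1 <= pr P G)%R by apply: pr_le => // x lx; exists n.
  have Gh' : (pr P G <= pr P (s n).2)%R by apply: pr_le.
  have E : (pr P (s n).2 = pr P (s n).1 + pr P (F n))%R.
    by rewrite (@prID P (s n).2 (s n).1)// (setIidr lh).
  by rewrite ler_norml; lra.
apply/eqP; rewrite -subr_eq0 -normr_le0; apply/ler_addgt0Pr => e e0; rewrite add0r.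
have [n _ /(_ n (leqnn n)) /= /ltW Fe] := pr_vanish mF FS F0 e0.
exact: le_trans (close n) Fe.
Qed.

End real_probability.

(** * Likelihood ratios and the atomless Neyman-Pearson lemma *)

Section neyman_pearson.
Context d (T : measurableType d) (R : realType).
Implicit Types (P : probability T R) (A B : set T).

(** The function is a real-valued Radon-Nikodym density of [P1]. Integrating a pointwise bound on it
    over [A] compares the two masses, which is the form used by the exchange argument. *)
Lemma likelihood_ratio P0 P1 : P1 `<< P0 ->
  exists f : T -> R, [/\ measurable_fun setT f, forall x, (0 <= f x)%R,
    forall (c : R) A, measurable A -> A `<=` [set x | f x <= c]%R ->
      (pr P1 A <= c * pr P0 A)%R &
    forall (c : R) A, measurable A -> A `<=` [set x | c <= f x]%R ->
      (c * pr P0 A <= pr P1 A)%R].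
Proof.
move=> /radon_nikodym_sigma_finite[f [f0 ffin fint fE]].
pose g x := fine (f x); have fg x : f x = (g x)%:E by rewrite /g fineK.
have mf : measurable_fun setT f by exact: measurable_int fint.
have mg : measurable_fun setT g by exact: measurableT_comp mf.
exists g; split => // [x|c A mA Ac|c A mA Ac]; first exact: fine_ge0.
- rewrite -lee_fin EFinM -!prE// fE// -integral_cst//.
  apply: ge0_le_integral => //; last by move=> x /Ac; rewrite fg lee_fin.
  exact: measurable_funS mf.
(* For negative [c] the left-hand side is nonpositive and the bound is trivial. *)
- have [c0|c0] := leP 0%R c; last first.
    apply: le_trans (pr_ge0 _ _); rewrite -oppr_ge0 -mulNr mulr_ge0 ?pr_ge0//.
    by rewrite oppr_ge0 ltW.
  rewrite -lee_fin EFinM -!prE// fE// -integral_cst//.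
  apply: ge0_le_integral => //; last by move=> x /Ac; rewrite fg lee_fin.
  exact: measurable_funS mf.
Qed.

(* The multiplier [c] certifies [G] as optimal up to [e]; the slack [e] is needed
   only when [b = 0] and the likelihood ratio is unbounded. *)
Lemma atomless_neyman_pearson P0 P1 (U : nat -> set T) (E : set T) (b : R) :
  P1 `<< P0 -> separating U -> (forall n, measurable (U n)) ->
  measurable E -> (forall x, E x -> P0 [set x] = 0) -> (0 <= b)%R ->
  exists G, [/\ measurable G, G `<=` E, (pr P0 G <= b)%R &
    forall e : R, (0 < e)%R -> exists2 c : R, (0 <= c)%R &
      forall D, measurable D -> D `<=` E ->
        (pr P1 D <= pr P1 G + e + c * (pr P0 D - b))%R].
Proof.
move=> P10 sU mU mE E0 b0.
have [f [mf f0 fle fge]] := likelihood_ratio P10.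
have mgt c : measurable [set x | c < f x]%R.
  rewrite (_ : mkset _ = f @^-1` `]c, +oo[).
    by have := mf measurableT _ (measurable_itv `]c, +oo[); rewrite setTI.
  by apply/seteqP; split => x /=; rewrite in_itv/= andbT.
have mge c : measurable [set x | c <= f x]%R.
  rewrite (_ : mkset _ = f @^-1` `[c, +oo[).
    by have := mf measurableT _ (measurable_itv `[c, +oo[); rewrite setTI.
  by apply/seteqP; split => x /=; rewrite in_itv/= andbT.
(* The ratio is finite everywhere, so these sets decrease to the empty set and their masses
   vanish. *)
pose F n := [set x | n%:R < f x]%R.
have FS n : F n.+1 `<=` F n.
  by move=> x /=; apply: le_lt_trans; rewrite ler_nat.
have F0 : \bigcap_n F n = set0.
  rewrite -subset0 => x /(_ (Num.truncn (f x)).+1 I); rewrite /F /=.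
  by move=> /lt_trans/(_ (truncnS_gt _)); rewrite ltxx.
have vanish P (e : R) : (0 < e)%R -> exists n, (pr P (F n) < e)%R.
  move=> e0; have [||//||n _ nP] := @pr_vanish _ _ _ P F e.
  - by move=> n; exact: mgt.
  - exact: FS.
  - by rewrite F0.
  - exact: e0.
  by exists n; apply: nP => /=.
have [Eb|bE] := leP (pr P0 E) b.
  exists E; split => // e e0; exists 0%R => // D mD DE.
  by rewrite mul0r addr0; apply: ler_wpDr; [exact: ltW|exact: pr_le].
(* With no budget the empty region is chosen: off [F n] the ratio is at most [n], so the multiplier
   [n] pays for [D] there, and the slack [e] covers the [P1]-mass of [F n]. *)
have [b0'|b0'] := eqVneq b 0%R.
  have pr0 P : pr P set0 = 0%R by rewrite /pr measure0.
  exists set0; rewrite pr0 b0'; split => // e e0.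
  have [n ne] := vanish P1 e e0; exists n%:R => // D mD DE.
  rewrite pr0 add0r subr0 (prID P1 mD (mgt n%:R)) lerD//.
    apply: le_trans (ltW ne); apply: pr_le => //; [exact: measurableI|exact: mgt].
  have mD' : measurable (D `\` F n) by apply: measurableD => //; exact: mgt.
  apply: (@le_trans _ _ (n%:R * pr P0 (D `\` F n))%R).
    by apply: fle => // x [_] /negP; rewrite -leNgt.
  by apply: ler_wpM2l => //; apply: pr_le => // x [].
pose Egt c := E `&` [set x | c < f x]%R; pose Ege c := E `&` [set x | c <= f x]%R.
have mEgt c : measurable (Egt c) by exact: measurableI.
have mEge c : measurable (Ege c) by exact: measurableI.
(* The critical value is the infimum of the thresholds whose strict superlevel set fits in the
   budget. The claims [gtb] and [geb] bracket [b] between the masses of its strict and weak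
   superlevel sets. *)
pose S := [set c | 0 <= c /\ pr P0 (Egt c) <= b]%R; pose c := inf S.
have Slb : has_lbound S by exists 0%R => x [].
have [n nb] : exists n, (pr P0 (F n) < b)%R by apply: vanish; rewrite lt_def b0'.
have Sn : S n%:R.
  by split => //; apply: le_trans (ltW nb); apply: pr_le => // [|x []//]; exact: mgt.
have iS : has_inf S by split => //; exists n%:R.
have c0 : (0 <= c)%R by apply: lb_le_inf => [|x []//]; exists n%:R.
have gtb : (pr P0 (Egt c) <= b)%R.
  (* Continuity from below: [Egt c] is the increasing union of these sets, each contained in the
     superlevel set of some threshold of [S]. *)
  pose V k := Egt (c + k.+1%:R^-1)%R.
  have Vb k : (pr P0 (V k) <= b)%R.
    have [x [x0 xb] xc] := @inf_adherent _ S k.+1%:R^-1 (ltac:(by rewrite invr_gt0)) iS.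
    apply: le_trans xb; apply: pr_le; [exact: mEgt|exact: mEgt|].
    move=> y [Ey /= cy]; split => //=.
    exact: lt_trans cy.
  have VS k : V k `<=` V k.+1.
    move=> y [Ey /= cy]; split => //=; apply: le_lt_trans cy.
    by rewrite lerD2l lef_pV2 ?posrE// ler_nat.
  have VE : Egt c = \bigcup_k V k.
    apply/seteqP; split => [x [Ex /= cx]|x [k _ [Ex /= cx]]].
      have [k kP] := ltr_add_invr cx; by exists k.
    by split => //=; apply: lt_trans cx; rewrite ltrDl invr_gt0.
  have Vc := @pr_cvg_bigcup _ _ _ P0 V (fun k => mEgt _) VS.
  rewrite VE -(cvg_lim _ Vc)//; apply: limr_le; first by apply/cvg_ex; eexists; exact: Vc.
  by apply: nearW => k; exact: Vb.
have geb : (b <= pr P0 (Ege c))%R.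
  have [c0'|c0'] := eqVneq c 0%R.
    by rewrite (_ : Ege c = E) ?ltW// c0' /Ege (setIidl _)// => x _; exact: f0.
  have {}c0' : (0 < c)%R by rewrite lt_def c0'.
  (* These thresholds lie strictly below [c] yet stay nonnegative, as membership in [S] requires.
     Being outside [S], they have superlevel sets exceeding the budget, and those decrease to
     [Ege c]. *)
  pose V k := Egt (c - c / k.+1%:R)%R.
  have Vb k : (b <= pr P0 (V k))%R.
    rewrite leNgt; apply/negP => /ltW kb.
    have : S (c - c / k.+1%:R)%R.
      split => //; rewrite subr_ge0 ler_piMr// invf_le1//.
      by rewrite ler1n.
    move=> /(ge_inf Slb); rewrite -/c leNgt => /negP; apply.
    by rewrite gtrDl oppr_lt0 divr_gt0.
  have VS k : V k.+1 `<=` V k.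
    move=> y [Ey /= cy]; split => //=; apply: le_lt_trans cy.
    by rewrite lerD2l lerN2 ler_pM2l// lef_pV2 ?posrE// ler_nat.
  have VE : Ege c = \bigcap_k V k.
    apply/seteqP; split => [x [Ex /= cx] k _|x Vx].
      by split => //=; apply: lt_le_trans cx; rewrite gtrDl oppr_lt0 divr_gt0.
    split => /=; first by case: (Vx 0%N I).
    rewrite leNgt; apply/negP => /[dup] xc; rewrite -subr_gt0 => xc0.
    have := divr_gt0 xc0 c0' => /[dup] z0 /ltr_add_invr[k].
    rewrite add0r ltr_pdivlMr// mulrC => kP.
    have [_ /=] := Vx k I; rewrite ltNge => /negP; apply.
    by rewrite lerBrDl -lerBrDr ltW.
  have Vc := @pr_cvg_bigcap _ _ _ P0 V (fun k => mEgt _) VS.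
  rewrite VE -(cvg_lim _ Vc)//; apply: limr_ge; first by apply/cvg_ex; eexists; exact: Vc.
  by apply: nearW => k; exact: Vb.
(* In place of randomization, the boundary where the ratio equals [c] is split so as to spend
   exactly [b]; this is where the absence of point masses in [E] enters. *)
have [|||||G [mG gtG Gge Gb]] := @pr_intermediate _ _ _ P0 U (Egt c) (Ege c) b sU mU.
- exact: mEgt.
- exact: mEge.
- by move=> x [Ex /= /ltW].
- by move=> x [[Ex _] _]; exact: E0.
- by rewrite gtb.
exists G; split => //; [by move=> x /Gge[]|by rewrite Gb|].
move=> e e0; exists c => // D mD DE.
(* Exchange argument: the ratio is at most [c] on [D] outside [G] and at least [c] on [G] outside
   [D], and the common part cancels. *)
have mDG := measurableD mD mG; have mGD := measurableD mG mD.
have DG : (pr P1 (D `\` G) <= c * pr P0 (D `\` G))%R.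
  apply: fle => // x [/DE Ex Gx] /=; rewrite leNgt; apply/negP => cx.
  by apply: Gx; exact: gtG.
have GD : (c * pr P0 (G `\` D) <= pr P1 (G `\` D))%R.
  by apply: fge => // x [/Gge[]].
move: DG GD; rewrite -Gb (prID P1 mD mG) (prID P1 mG mD) (prID P0 mD mG) (prID P0 mG mD).
rewrite (setIC G D); lra.
Qed.

End neyman_pearson.

(** * Existence of an optimal region in the presence of point masses *)

Section optimal_region.
Context d (T : measurableType d) (R : realType).
Implicit Types (P : probability T R) (A B : set T).

(** For each [n] only finitely many points have mass above [1/(n+1)], since [n+1] of them would have
    total mass above 1. *)
Lemma countable_point_masses P (U : nat -> set T) :
  separating U -> (forall n, measurable (U n)) ->
  countable [set x | P [set x] != 0].
Proof.
move=> sU mU; have m1 (x : T) : measurable [set x] := separating_measurable1 x sU mU.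
rewrite (_ : mkset _ = \bigcup_n [set x | n.+1%:R^-1 < pr P [set x]]%R); last first.
  apply/seteqP; split => [x /= x0|x [n _ /= nx]].
    have : (0 < pr P [set x])%R by rewrite -lte_fin -prE// lt0e x0/=.
    by move=> /ltr_add_invr[n]; rewrite add0r; exists n.
  by rewrite prE// eqe gt_eqF//; apply: lt_trans nx.
apply: bigcup_countable => // n _; apply: finite_set_countable.
apply: contrapT => /infiniteP/pcard_leP/injfunPex[/= q q_fun q_inj].
have tq : trivIset setT (fun k => [set q k]).
  apply/trivIsetP => i j _ _ ij; rewrite -subset0 => x [/= -> /q_inj].
  by rewrite !in_setT => /(_ isT isT)/eqP; rewrite (negbTE ij).
have sumq m : pr P (\big[setU/set0]_(k < m) [set q k]) = (\sum_(k < m) pr P [set q k])%R.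
  elim: m => [|m IH]; first by rewrite !big_ord0 /pr measure0.
  rewrite !big_ord_recr/= prU_disj ?IH//.
    by apply: bigsetU_measurable.
  rewrite -(bigcup_mkord m (fun k => [set q k])) -subset0 => x [[k /= km ->]] /q_inj.
  by rewrite !in_setT => /(_ isT isT) E; rewrite E ltnn in km.
have : (pr P (\big[setU/set0]_(k < n.+1) [set q k]) <= 1)%R.
  by apply: pr_le1; exact: bigsetU_measurable.
rewrite sumq leNgt => /negP; apply.
rewrite [ltLHS](_ : 1%R = (\sum_(k < n.+1) n.+1%:R^-1:R)%R); last first.
  by rewrite sumr_const card_ord -[RHS]mulr_natr mulVf.
apply: ltr_sum => [|k _]; last exact: q_fun.
by apply/hasP; exists ord0; rewrite ?mem_index_enum.
Qed.

(* The maximal power [V] is attained by splitting the space into the countably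
   many point masses [A] and the atomless rest: one decides point mass by point
   mass whether to keep it without lowering the supremum, then spends the
   remaining budget optimally on the rest. *)
Theorem optimal_region_exists P0 P1 (U : nat -> set T) (alpha : R) :
  P1 `<< P0 -> separating U -> (forall n, measurable (U n)) -> (0 <= alpha)%R ->
  exists G, [/\ measurable G, (pr P0 G <= alpha)%R &
    forall D, measurable D -> (pr P0 D <= alpha)%R -> (pr P1 D <= pr P1 G)%R].
Proof.
move=> P10 sU mU a0; pose A := [set x | P0 [set x] != 0].
have cA : countable A by exact: countable_point_masses sU mU.
have m1 (x : T) : measurable [set x] := separating_measurable1 x sU mU.
have mA B : B `<=` A -> measurable B.
  by move=> BA; apply: countable_measurable => //; exact: sub_countable (subset_card_le BA) cA.
have /countable_injP[p pinj] := cA.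
pose feas D := measurable D /\ (pr P0 D <= alpha)%R.
pose Vs := [set pr P1 D | D in feas]; pose V := sup Vs.
have feas0 : feas set0 by split; rewrite // /pr measure0.
have hV : has_sup Vs.
  split; first by exists (pr P1 set0); exists set0.
  by exists 1%R => _ [D [mD _] <-]; exact: pr_le1.
(* The invariant of the greedy choice: fixing the decisions on the point masses numbered below [k]
   as in [S] does not lower the supremum [V]. *)
pose good k S := forall e : R, (0 < e)%R -> exists D, [/\ feas D, (V - e < pr P1 D)%R &
  forall x, A x -> (p x < k)%N -> (D x <-> S x)].
pose cell k := [set x | A x /\ p x = k].
pose s := fix s k := if k is k'.+1 then
  (if `[< good k'.+1 (s k' `|` cell k') >] then s k' `|` cell k' else s k') else set0.
have sA k x : s k x -> A x /\ (p x < k)%N.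
  elim: k => //= k IH; case: asboolP => _; last by move=> /IH[? /ltnW]; rewrite ltnS.
  by move=> [/IH[? /ltnW]|[? ->]]; rewrite ltnS.
have goodS k : good k (s k).
  elim: k => [|k IH].
    by move=> e e0; have [_ [D fD <-] VD] := sup_adherent e0 hV; exists D.
  (* If adding point mass [k] fails at tolerance [e1], every feasible region within the smaller
     tolerance of [V] that agrees so far must omit it, so dropping it keeps the invariant. *)
  rewrite /=; case: asboolP => // /existsNP[e1 /not_implyP[e10 /forallNP N1]] e e0.
  have me : (0 < Num.min e e1)%R by rewrite lt_min e0.
  have [D [fD VD DS]] := IH _ me; exists D; split => //.
    by apply: le_lt_trans VD; rewrite lerD2l lerN2 ge_min lexx.
  move=> x Ax; rewrite ltnS leq_eqVlt => /predU1P[pxk|]; last exact: DS.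
  split=> [Dx|/sA[_]]; last by rewrite pxk ltnn.
  exfalso; apply: (N1 D); split => //.
    by apply: le_lt_trans VD; rewrite lerD2l lerN2 ge_min lexx orbT.
  move=> y Ay; rewrite ltnS leq_eqVlt => /predU1P[pyk|pyk]; split.
  - by move=> _; right.
  - suff -> : y = x by [].
    by apply: pinj; rewrite ?inE// pyk.
  - by move=> /(DS _ Ay pyk); left.
  - by move=> [/(DS _ Ay pyk)//|[_ pyk']]; rewrite pyk' ltnn in pyk.
pose S := \bigcup_k s k.
have Ss k x : (p x < k)%N -> S x <-> s k x.
  move=> xk; split => [[m _ smx]|]; last by exists k.
  have [_ pxm] := sA _ _ smx.
  have step j : (p x < j)%N -> s j.+1 x <-> s j x.
    move=> xj /=; case: asboolP => // _; split; last by left.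
    by move=> [//|[_ xj']]; rewrite xj' ltnn in xj.
  have up a j : (p x < a)%N -> s (j + a)%N x <-> s a x.
    move=> xa; elim: j => // j IH; rewrite addSn step//.
    exact: leq_trans xa (leq_addl _ _).
  by have := up _ m xk; rewrite addnC; have := up _ k pxm => -> <-.
have SA : S `<=` A by move=> x [k _ /sA[]].
have mS : measurable S by exact: mA.
(* These are the point masses still undecided at stage [k]. Their total mass tends to 0, which
   controls the passage from finite stages to [S]. *)
pose tl k := A `&` [set x | k <= p x]%N.
have mtl k : measurable (tl k) by apply: mA => x [].
have tlS k : tl k.+1 `<=` tl k by move=> x [? /= /ltnW].
have tl0 : \bigcap_k tl k = set0.
  by rewrite -subset0 => x /(_ (p x).+1 I)[_ /=]; rewrite ltnn.
have vanish P (e : R) : (0 < e)%R -> \forall k \near \oo, (pr P (tl k) < e)%R.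
  by move=> e0; apply: pr_vanish => //; rewrite tl0.
have goodSk k : good k S.
  move=> e e0; have [D [fD VD DS]] := goodS k e e0; exists D; split => //.
  by move=> x Ax xk; exact: iff_trans (DS x Ax xk) (iff_sym (Ss k x xk)).
have DSsub k D : (forall x, A x -> (p x < k)%N -> (D x <-> S x)) ->
    D `&` A `<=` S `|` tl k /\ S `<=` (D `&` A) `|` tl k.
  move=> DS; split => x.
    move=> [Dx Ax]; have [kx|xk] := leqP k (p x); first by right.
    by left; apply/DS.
  move=> Sx; have Ax := SA _ Sx; have [kx|xk] := leqP k (p x); first by right.
  by left; split => //; apply/DS.
have mAA : measurable A by exact: mA.
pose b := (alpha - pr P0 S)%R.
(* Up to a tail of small mass, [S] lies in a feasible region, hence meets the budget itself. *)
have b0 : (0 <= b)%R.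
  rewrite subr_ge0; apply/ler_addgt0Pr => e e0.
  have [k _ /(_ k (leqnn k)) /= ke] := vanish P0 e e0.
  have [D [[mD Da] _ /DSsub[_ SD]]] := goodSk k 1%R ltr01.
  apply: (le_trans (pr_le P0 mS _ SD)); first by apply: measurableU => //; exact: measurableI.
  apply: (le_trans (prU P0 _ (mtl k))); first exact: measurableI.
  apply: lerD (ltW ke); apply: le_trans Da; apply: pr_le => //; exact: measurableI.
have mE : measurable (~` A) by exact: measurableC.
have [|G [mG GE Gb Gopt]] := @atomless_neyman_pearson _ _ _ P0 P1 U (~` A) b P10 sU mU mE _ b0.
  by move=> x /= /negP; rewrite negbK => /eqP.
have SG : S `&` G = set0 by rewrite -subset0 => x [/SA Ax /GE].
exists (S `|` G); split; first exact: measurableU.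
  by rewrite prU_disj// -lerBrDl.
move=> D0 mD0 D0a; apply: (@le_trans _ _ V).
  by apply: ub_le_sup; [case: hV|exists D0].
rewrite prU_disj//; apply/ler_addgt0Pr => e' e'0.
(* Four errors add up: the gap between [V] and the power of [D], the tail under [P1], the slack in
   the optimality of [G], and the overspending of [D] off [A], priced at [c]. *)
pose e := (e' / 4)%R; have e0 : (0 < e)%R by rewrite /e; lra.
have [c c0 Gc] := Gopt e e0.
(* The denominator [c + 1] stays positive when [c = 0], and [c] times this bound is at most [e]. *)
have ec0 : (0 < e / (c + 1))%R by rewrite divr_gt0//; lra.
have [k _ /(_ k (leqnn k)) /= [ke1 ke0]] : \forall k \near \oo,
    (pr P1 (tl k) < e)%R /\ (pr P0 (tl k) < e / (c + 1))%R.
  by near=> k; split; near: k; exact: vanish.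
have [D [[mD Da] VD /DSsub[DS SD]]] := goodSk k e e0.
have mDA : measurable (D `&` A) by exact: measurableI.
have h1 : (pr P1 (D `&` A) <= pr P1 S + e)%R.
  apply: (le_trans (pr_le P1 mDA _ DS)); first exact: measurableU.
  by apply: (le_trans (prU P1 mS (mtl k))); rewrite lerD2l ltW.
have h2 : (pr P0 S <= pr P0 (D `&` A) + pr P0 (tl k))%R.
  apply: (le_trans (pr_le P0 mS _ SD)); first exact: measurableU.
  exact: prU.
have h3 := Gc (D `\` A) (measurableD mD mAA) (fun x => @proj2 _ _).
(* On [A], [D] spends at least the mass of [S] up to the tail, so off [A] it exceeds [b] by at most
   the mass of the tail. *)
have h4 : (c * (pr P0 (D `\` A) - b) <= e)%R.
  apply: (@le_trans _ _ (c * (e / (c + 1)))%R).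
    apply: ler_wpM2l => //; move: Da; rewrite (prID P0 mD mAA) /b; lra.
  rewrite mulrA ler_pdivrMr; last lra.
  rewrite mulrC ler_pM2l//; lra.
move: VD; rewrite (prID P1 mD mAA).
have : e' = (4 * e)%R by rewrite /e; lra.
lra.
Unshelve. all: by end_near. Qed.
End optimal_region.

(** * Countable separating families *)

(** The sets are preimages of small balls around a countable dense set: points lying in the same
    sets have arbitrarily close images, hence are equal by the Hausdorff property and
    injectivity. *)
Lemma standard_borel_separating (R : realType) d (X : measurableType d) :
  standard_borel R X ->
  exists2 U : nat -> set X, separating U & forall n, measurable (U n).
Proof.
move=> [Y [f [hY [D /countable_injP[p pinj] dD] bf mX]]].
(* The code [p] selects at most one centre, and interiors are taken because a ball need not be
   open. *)
pose V (kn : nat * nat) : set Y :=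
  \bigcup_(z in [set z | D z /\ p z = kn.1]) interior (ball z (kn.2.+1%:R^-1 : R)).
pose U m := if unpickle m is Some kn then f @^-1` V kn else set0.
have mU m : measurable (U m).
  rewrite /U; case: (unpickle m) => // kn; rewrite mX; exists (V kn); last by rewrite setTI.
  by apply: sub_gen_smallest; apply: bigcup_open => z _; exact: open_interior.
exists U => // x y xy; apply: (bij_inj bf); apply: (close_eq hY).
rewrite ball_close => e.
have e2 : (0 < e%:num / 2 :> R)%R by [].
have [n] := ltr_add_invr e2; rewrite add0r; set r := (n.+1%:R^-1 : R)%R => ne.
have r0 : (0 < r)%R by rewrite invr_gt0.
have r2 : (0 < r / 2)%R by rewrite divr_gt0.
(* A centre within [r / 2] of [f x] ensures that [f x] lies in the interior of the ball of radius
   [r]. *)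
have [z [zx Dz]] := dD (interior (ball (f x) (r / 2))) (ex_intro _ (f x) (nbhsx_ballx _ _ r2))
  (@open_interior _ _).
move/interior_subset in zx.
have Ux : U (pickle (p z, n)) x.
  rewrite /U pickleK; exists z => //; apply/nbhs_ballP; exists (r / 2)%R => //= w xw.
  by rewrite [X in ball _ X](splitr r); exact: ball_triangle (ball_sym zx) xw.
have : U (pickle (p z, n)) y by apply/xy.
rewrite /U pickleK => -[z' [Dz' pz']] /interior_subset zy.
have E : z' = z by apply: pinj; rewrite ?inE.
rewrite {}E in zy; apply: (le_ball _ (ball_triangle zx zy)).
by rewrite -/r; lra.
Qed.

Lemma tuple_separating d (X : measurableType d) (U : nat -> set X) n :
  separating U -> (forall m, measurable (U m)) ->
  exists2 V : nat -> set (n.-tuple X), separating V & forall m, measurable (V m).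
Proof.
move=> sU mU.
pose V m : set (n.-tuple X) := if unpickle m is Some im then
  (fun h => tnth h (im : 'I_n * nat).1) @^-1` U im.2 else set0.
exists V => [x y xy|m].
  apply: eq_from_tnth => i; apply: sU => k.
  by have := xy (pickle (i, k)); rewrite /V pickleK.
rewrite /V; case: (unpickle m) => // im.
by have := @measurable_tnth _ X n im.1 measurableT _ (mU im.2); rewrite setTI.
Qed.

(** * Laws of the first observations and their absolute continuity *)

Section tuple_laws.
Context {R : realType} {d} {X : measurableType d}.
Implicit Types (pi : probability X R) (P : probability (pathspace X) R).

Lemma measurable_history t : measurable_fun setT (@history d X t).
Proof.
apply/measurable_fun_tnthP => i; rewrite (_ : _ \o _ = fun x : pathspace X => x i).
  exact: measurable_coord.
by apply/funext => x /=; rewrite tnth_mktuple.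
Qed.

HB.instance Definition _ t := isMeasurableFun.Build _ _ _ _ (@history d X t)
  (@measurable_history t).

Lemma measurable_cyl t (B : set (t.-tuple X)) : measurable B -> measurable (cyl B).
Proof. by move=> mB; have := @measurable_history t measurableT _ mB; rewrite setTI. Qed.

Definition history_law P t : probability (t.-tuple X) R := distribution P (@history d X t).

Lemma history_lawE P t B : history_law P t B = P (cyl B).
Proof. by []. Qed.

Definition box n (A : nat -> set X) : set (n.-tuple X) :=
  [set h | forall i : 'I_n, A i (tnth h i)].

Arguments box : clear implicits.

Lemma measurable_box n (A : nat -> set X) : (forall i, measurable (A i)) ->
  measurable (box n A).
Proof.
move=> mA; rewrite (_ : box n A = \bigcap_i (if insub i is Some j then
    (fun h => tnth h (j : 'I_n)) @^-1` A j else setT)).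
  apply: bigcapT_measurable => i; case: insub => // j.
  by have := measurable_tnth j measurableT (mA j); rewrite setTI.
apply/seteqP; split => [h Ah i _|h Ah i]; first by case: insub.
by have := Ah i I; rewrite valK.
Qed.

(** Boxes are stable under intersection and generate the sigma-algebra of tuples, so the uniqueness
    theorem for measures applies. *)
Lemma box_unique n (m1 m2 : probability (n.-tuple X) R) :
  (forall A, (forall i, measurable (A i)) -> m1 (box n A) = m2 (box n A)) ->
  forall B, measurable B -> m1 B = m2 B.
Proof.
move=> m12; pose G := [set box n A | A in [set A | forall i, measurable (A i)]].
have GT : G setT by exists (fun=> setT) => //; apply/seteqP; split.
have Gm : G `<=` measurable by move=> _ [A mA <-]; exact: measurable_box.
move=> B mB; apply: (@g_sigma_algebra_measure_unique _ _ _ G _ (fun=> setT)) => //.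
- by apply/seteqP; split => // h _; exists 0%N.
- move=> _ _ [A mA <-] [A' mA' <-]; exists (fun i => A i `&` A' i).
    by move=> i; exact: measurableI.
  by apply/seteqP; split => [h H|h [H1 H2] i]; [split=> i; case: (H i)|split].
- by move=> _ [A mA <-]; exact: m12.
- by move=> k; exact: le_lt_trans (probability_le1 m1 measurableT) (ltry _).
- move: B mB; apply: smallest_sub; first exact: smallest_sigma_algebra.
  move=> B; rewrite -bigcup_seq => -[i _ [A mA <-]]; rewrite setTI.
  (* A constraint on one coordinate is a box whose other sides are the whole space. *)
  apply: sub_sigma_algebra; exists (fun j : nat => if j == i then A else setT).
    by move=> j; case: ifP.
  apply/seteqP; split => [h /(_ i)|h Ah j]; first by rewrite eqxx.
  by case: ifP => // /eqP/val_inj ->.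
Qed.

Lemma iid_law_box pi P n A : is_iid_law pi P -> (forall i, measurable (A i)) ->
  history_law P n (box n A) = \prod_(i < n) pi (A i).
Proof.
move=> iP mA; rewrite -(iP n A mA) history_lawE; congr (P _).
apply/seteqP; split => [x Ax i il|x Ax i]; last by rewrite tnth_mktuple; exact: Ax.
by have := Ax (Ordinal il); rewrite tnth_mktuple.
Qed.

Definition tuple_rcons n (p : n.-tuple X * X) : n.+1.-tuple X := [tuple of rcons p.1 p.2].

Lemma measurable_rcons n : measurable_fun setT (@tuple_rcons n).
Proof.
apply/measurable_fun_tnthP => i; have := ltn_ord i.
rewrite ltnS leq_eqVlt => /predU1P[iE|il].
  rewrite (_ : _ \o _ = snd); first exact: measurable_snd.
  apply/funext => -[h y] /=; rewrite (tnth_nth y)/= nth_rcons size_tuple.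
  by rewrite iE ltnn eqxx.
rewrite (_ : _ \o _ = (fun h => tnth h (Ordinal il)) \o fst).
  exact: (measurableT_comp (measurable_tnth _) measurable_fst).
apply/funext => -[h y] /=.
by rewrite !(tnth_nth y)/= nth_rcons size_tuple il.
Qed.

(** Both sides give a box the product of the masses of its sides. Splitting off the last observation
    makes Fubini available for an induction on the length. *)
Lemma history_lawS pi P n B : is_iid_law pi P -> measurable B ->
  history_law P n.+1 B =
  (history_law P n \x pi) (@tuple_rcons n @^-1` B).
Proof.
move=> iP; 
pose phim := isMeasurableFun.Build _ _ _ _ (@tuple_rcons n) (@measurable_rcons n).
pose phi' : {mfun _ >-> _} := HB.pack (@tuple_rcons n) phim.
apply: (box_unique (m2 := distribution (history_law P n \x pi) phi')).
move=> A mA.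
have E : @tuple_rcons n @^-1` box n.+1 A = box n A `*` A n.
  apply/seteqP; split => [[h y] H|[h y] [Hh Hy] i].
    split => /= [i|].
      have := H (widen_ord (leqnSn n) i).
      by rewrite !(tnth_nth y)/= nth_rcons size_tuple ltn_ord.
    have := H ord_max.
    by rewrite (tnth_nth y)/= nth_rcons size_tuple ltnn eqxx.
  have := ltn_ord i; rewrite ltnS leq_eqVlt => /predU1P[iE|il].
    by rewrite (tnth_nth y)/= nth_rcons size_tuple iE ltnn eqxx.
  rewrite (tnth_nth y)/= nth_rcons size_tuple il.
  by have := Hh (Ordinal il); rewrite (tnth_nth y).
rewrite (iid_law_box _ iP)//.
transitivity ((history_law P n \x pi) (box n A `*` A n)); last by rewrite -E.
rewrite product_measure1E//; last exact: measurable_box.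
by rewrite big_ord_recr/=; congr (_ * _); exact/esym/iid_law_box.
Qed.

(** Induction on [n]: a null set of the product law has almost all its sections null for [pi0],
    hence for [pi1], and the induction hypothesis transfers the exceptional null set of shorter
    histories. *)
Lemma history_law_dominates pi0 pi1 P0 P1 n : pi1 `<< pi0 ->
  is_iid_law pi0 P0 -> is_iid_law pi1 P1 -> history_law P1 n `<< history_law P0 n.
Proof.
move=> /null_content_dominatesP pi10 iP0 iP1.
elim: n => [|n IH]; apply/null_content_dominatesP => B mB.
  (* There is a single empty tuple, so [B] is either everything, of mass 1, or empty. *)
  have [B0|B0] := pselect (B [tuple]).
    rewrite (_ : B = setT); last first.
      by apply/seteqP; split => // h _; rewrite (tuple0 h).
    by move=> /eqP; rewrite [X in X == _]probability_setT onee_eq0.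
  by rewrite (_ : B = set0) ?measure0// -subset0 => h; rewrite (tuple0 h).
pose C := @tuple_rcons n @^-1` B.
suff : (history_law P0 n \x pi0) C = 0 -> (history_law P1 n \x pi1) C = 0.
  by rewrite -(history_lawS iP0 mB) -(history_lawS iP1 mB).
have mC : measurable C by have := @measurable_rcons n measurableT _ mB; rewrite setTI.
have msec (pi : probability X R) : measurable_fun setT (pi \o xsection C).
  exact: measurable_fun_xsection.
rewrite /= /product_measure1 => C0.
have int0 (mu : probability (n.-tuple X) R) (pi : probability X R) :
    \int[mu]_x (pi \o xsection C) x = 0 <->
    ae_eq mu setT (pi \o xsection C) (cst 0).
  rewrite -ae_eq_integral_abs//.
  by under [X in _ <-> X = _]eq_integral do rewrite gee0_abs//.
move/int0 : C0 => /(null_dominates_ae_eq measurableT IH) C0; apply/int0.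
by apply: filterS C0 => h /(_ I) C0 _; exact: (pi10 (xsection C h) (measurable_xsection _ mC) C0).
Qed.

End tuple_laws.

(** * Infima of sets of times *)

Section first_times.
Implicit Types (S : set nat).

Lemma first_timeP S n : first_time S = Some n <-> S n /\ forall m, S m -> (n <= m)%N.
Proof.
rewrite /first_time; case: xgetP => [y -> [k [Sk kmin] <-]|none].
  split => [[<-]//|[Sn nmin]]; congr Some; apply/eqP.
  by rewrite eqn_leq kmin//= nmin.
by split=> // Sn; exfalso; apply: (none (Some n)); exists n.
Qed.

Lemma first_time_le S t : time_le (first_time S) t <-> exists2 n, S n & (n <= t)%N.
Proof.
split => [|[n Sn nt]].
  case E : (first_time S) => [n|]//= nt.
  by move/first_timeP : E => [Sn _]; exists n.
have exS : exists n, `[< S n >] by exists n; exact/asboolP.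
have [m /asboolP Sm mmin] := ex_minnP exS.
have /first_timeP -> : S m /\ forall k, S k -> (m <= k)%N.
  by split => // k Sk; apply: mmin; exact/asboolP.
by apply: leq_trans nt; apply: mmin; exact/asboolP.
Qed.

End first_times.

(** * Stopping times and rejection by an e-process *)

Section stopping.
Context {R : realType} {d} {X : measurableType d}.
Implicit Types (P : probability (pathspace X) R) (tau : pathspace X -> option nat).
Implicit Types (U : forall t, t.-tuple X -> R).

(* When [n < t] the missing entries are filled with the junk value [point]. *)
Definition prefix t n (h : n.-tuple X) : t.-tuple X := [tuple nth point h i | i < t].

Lemma measurable_prefix t n : measurable_fun setT (@prefix t n).
Proof.
apply/measurable_fun_tnthP => i.
have [il|il] := ltnP i n.
  rewrite (_ : _ \o _ = (@tnth n X)^~ (Ordinal il)); first exact: measurable_tnth.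
  by apply/funext => h /=; rewrite tnth_mktuple (tnth_nth point).
rewrite (_ : _ \o _ = cst point); first exact: measurable_cst.
by apply/funext => h /=; rewrite tnth_mktuple nth_default// size_tuple.
Qed.

Lemma prefix_history t n (x : pathspace X) : (t <= n)%N ->
  prefix t (history n x) = history t x.
Proof.
move=> tn; apply: eq_from_tnth => i; rewrite !tnth_mktuple.
by rewrite -(tnth_nth point (history n x) (widen_ord tn i)) tnth_mktuple.
Qed.

Lemma measurable_prefix_preimage t n (B : set (t.-tuple X)) : measurable B ->
  measurable (@prefix t n @^-1` B).
Proof. by move=> mB; have := @measurable_prefix t n measurableT _ mB; rewrite setTI. Qed.

Lemma cyl_prefix t n (B : set (t.-tuple X)) : (t <= n)%N ->
  cyl B = cyl (@prefix t n @^-1` B).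
Proof. by move=> tn; apply/seteqP; split => x; rewrite /cyl /preimage /= prefix_history. Qed.

Lemma measurable_process U t : (forall t, measurable_fun setT (U t)) ->
  measurable_fun setT (fun x : pathspace X => (U t (history t x))%:E).
Proof.
move=> mU; apply/measurable_EFinP.
exact: measurableT_comp (mU t) (@measurable_history _ _ t).
Qed.

(** This is the rejection event seen inside [X^T], where it competes with the other level-[alpha]
    regions. *)
Definition rejection_region (alpha : R) U T : set (T.-tuple X) :=
  \bigcup_(t in [set t | (t <= T)%N]) @prefix t T @^-1` [set h | alpha^-1 <= U t h]%R.

Arguments rejection_region : clear implicits.

Lemma measurable_rejection_region alpha U T : (forall t, measurable_fun setT (U t)) ->
  measurable (rejection_region alpha U T).
Proof.
move=> mU; apply: bigcup_measurable => t _; apply: measurable_prefix_preimage.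
rewrite (_ : mkset _ = U t @^-1` `[(alpha^-1)%R, +oo[).
  by have := mU t measurableT _ (measurable_itv `[(alpha^-1)%R, +oo[); rewrite setTI.
by apply/seteqP; split => x /=; rewrite in_itv/= andbT.
Qed.

Lemma rejected_byP alpha U T (x : pathspace X) : rejected_by alpha U T x <->
  exists2 t, (alpha^-1 <= U t (history t x))%R & (t <= T)%N.
Proof. exact: first_time_le. Qed.

Lemma rejected_byE alpha U T : rejected_by alpha U T = cyl (rejection_region alpha U T).
Proof.
apply/seteqP; split => x.
  by move=> /rejected_byP[t Ut tT]; exists t => //; rewrite /preimage /= prefix_history.
move=> [t /= tT]; rewrite prefix_history// => Ut.
by apply/rejected_byP; exists t.
Qed.

(** Index 0 stands for the infinite value and index [n + 1] for time [n], so that the parts form a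
    single sequence. *)
Definition stop_part tau k : set (pathspace X) :=
  if k is n.+1 then [set x | tau x = Some n] else [set x | tau x = None].

(** The event is [tau <= n] minus [tau <= n - 1], both determined by the first [n] observations; at
    time 0 there is nothing to subtract. *)
Lemma stop_partS tau n : stopping_time tau ->
  exists2 B : set (n.-tuple X), measurable B & stop_part tau n.+1 = cyl B.
Proof.
move=> st; have [B mB] := st n; rewrite setTI => BE.
case: n B mB BE => [|n] B mB BE.
  exists B => //; rewrite [cyl B]BE; apply/seteqP; split => x /=; first by move=> ->.
  by case: (tau x) => //= m; rewrite leqn0 => /eqP ->.
have [B' mB'] := st n; rewrite setTI => BE'.
exists (B `\` @prefix n n.+1 @^-1` B').
  by apply: measurableD => //; exact: measurable_prefix_preimage.
rewrite (_ : cyl _ = cyl B `\` cyl (@prefix n n.+1 @^-1` B'))// -cyl_prefix//.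
rewrite [cyl B]BE [cyl B']BE'; apply/seteqP; split => x /=.
  by move=> -> /=; rewrite leqnn ltnn.
case: (tau x) => [m|[]//] /= [mn /negP]; rewrite -ltnNge => nm.
by congr Some; apply/eqP; rewrite eqn_leq mn.
Qed.

Lemma stop_part_cover tau : \bigcup_k stop_part tau k = setT.
Proof.
apply/seteqP; split => // x _; case E : (tau x) => [n|]; first by exists n.+1.
by exists 0%N.
Qed.

Lemma trivIset_stop_part tau : trivIset setT (stop_part tau).
Proof.
apply/trivIsetP => i j _ _ ij; rewrite -subset0 => x.
by case: i j ij => [|i] [|j]//= ij [] ->// [E]; rewrite E eqxx in ij.
Qed.

Lemma measurable_stop_part tau k : stopping_time tau -> measurable (stop_part tau k).
Proof.
move=> st; case: k => [|k]; last first.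
  by have [B mB ->] := stop_partS k st; exact: measurable_cyl.
rewrite (_ : stop_part tau 0 = ~` \bigcup_k stop_part tau k.+1).
  apply: measurableC; apply: bigcupT_measurable => k.
  by have [B mB ->] := stop_partS k st; exact: measurable_cyl.
apply/seteqP; split => x /=; first by move=> E [k _ /=]; rewrite E.
by move=> H; case E : (tau x) => [n|//]; exfalso; apply: H; exists n.
Qed.

Lemma measurable_stopped U tau : (forall t, measurable_fun setT (U t)) ->
  stopping_time tau -> measurable_fun setT (stopped U tau).
Proof.
move=> mU st; have mp k := measurable_stop_part k st.
rewrite -(stop_part_cover tau); apply/measurable_fun_bigcup => // -[|n].
  apply: (eq_measurable_fun (fun x => limn_esup (fun t => (U t (history t x))%:E))).
    by move=> x /set_mem /= E; rewrite /stopped E.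
  apply: measurable_funTS; apply: measurable_fun_limn_esup => t.
  exact: measurable_process.
apply: (eq_measurable_fun (fun x => (U n (history n x))%:E)).
  by move=> x /set_mem /= E; rewrite /stopped E.
by apply: measurable_funTS; exact: measurable_process.
Qed.

Lemma stopped_ge0 U tau x : (forall t h, 0 <= U t h)%R -> 0 <= stopped U tau x.
Proof.
move=> U0; rewrite /stopped; case: (tau x) => [n|]; first by rewrite lee_fin.
rewrite limn_esup_lim; apply: lime_ge; first exact: is_cvg_esups.
apply: nearW => n; apply: (@le_trans _ _ (U n (history n x))%:E).
  by rewrite lee_fin.
by apply: ereal_sup_ubound; exists n => //=.
Qed.

(* Markov's inequality at the rejection time truncated at [T]. *)
Lemma e_process_rejected P alpha U T : (0 < alpha)%R -> e_process P U ->
  P (rejected_by alpha U T) <= alpha%:E.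
Proof.
move=> a0 [mU U0 EU].
(* Without rejection by [T] the time is set to [T]. It is therefore bounded, and for [t < T] it is
   at most [t] exactly when rejection has occurred by [t]. *)
pose tau (x : pathspace X) :=
  if `[< rejected_by alpha U T x >] then rejection_time alpha U x else Some T.
have mr t : measurable (rejection_region alpha U t) by exact: measurable_rejection_region.
have st : stopping_time tau.
  move=> t; have [Tt|tT] := leqP T t.
    exists setT => //; rewrite setTI; apply/seteqP; split => // x _.
    rewrite /tau /=; case: asboolP => //.
    rewrite /rejected_by /=; case: (rejection_time alpha U x) => //= n nT.
    exact: leq_trans Tt.
  exists (rejection_region alpha U t); first exact: mr.
  rewrite setTI -[_ @^-1` _]/(cyl _) -rejected_byE.
  apply/seteqP; split => x /=; rewrite /tau /rejected_by /=.
    case: asboolP => //=; case: (rejection_time alpha U x) => //= n nT nt.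
    by exfalso; apply: nT; exact: leq_trans (ltnW tT).
  by case: asboolP => //= _; rewrite leqNgt tT.
have mrej : measurable (rejected_by alpha U T).
  by rewrite rejected_byE; exact: measurable_cyl.
have : \int[P]_(x in rejected_by alpha U T) (alpha^-1)%:E <= 1.
  apply: le_trans (EU _ st); apply: le_trans; last first.
    apply: (@ge0_subset_integral _ _ _ P (rejected_by alpha U T) setT) => //.
      exact: measurable_stopped.
    by move=> x _; exact: stopped_ge0.
  apply: ge0_le_integral => //.
  - by move=> x _; rewrite lee_fin invr_ge0 ltW.
  - by apply: measurable_funTS; exact: measurable_stopped.
  - move=> x rx; rewrite /stopped /tau asboolT//.
    move: rx; rewrite /rejected_by /=; case E : (rejection_time alpha U x) => [n|//] _.
    by rewrite lee_fin; move/first_timeP : E => [].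
rewrite integral_cst// -lee_pdivlMl ?invr_gt0// invrK mule1.
exact.
Qed.

End stopping.

Arguments rejection_region {R d X} alpha U T.

(** * Versions of conditional probabilities *)

Section conditional_probabilities.
Context {R : realType} {d} {X : measurableType d}.
Implicit Types (P : probability (pathspace X) R) (A : set (pathspace X)).

(** For nonnegative [q], integrability follows from the identity on the whole space, whose
    right-hand side is at most 1. *)
Lemma cond_probabilityP P A t (q : t.-tuple X -> R) : measurable A ->
  measurable_fun setT q -> (forall h, 0 <= q h)%R ->
  (forall B : set (t.-tuple X), measurable B ->
     \int[P]_(x in cyl B) (q (history t x))%:E = P (A `&` cyl B)) ->
  is_cond_probability P A q.
Proof.
move=> mA mq q0 qE; split => //; split => //.
  apply/integrableP; split.
    apply/measurable_EFinP; exact: measurableT_comp mq (@measurable_history _ _ t).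
  under eq_integral do rewrite gee0_abs ?lee_fin//.
  have := qE setT measurableT; rewrite {1}/cyl preimage_setT => ->.
  by apply: (le_lt_trans (probability_le1 P _)); rewrite ?ltry//; apply: measurableI => //;
    exact: measurable_cyl.
by move=> B mB; rewrite qE// integral_indic//; exact: measurable_cyl.
Qed.

Lemma cond_probability_int P A t (q : t.-tuple X -> R) (B : set (t.-tuple X)) : measurable A ->
  is_cond_probability P A q -> measurable B ->
  \int[P]_(x in cyl B) (q (history t x))%:E = P (A `&` cyl B).
Proof.
by move=> mA [[_ _ qE] _] mB; rewrite qE// integral_indic//; exact: measurable_cyl.
Qed.

(** Up to the factor [P A], the version is the Radon-Nikodym density of the law of the first [t]
    observations under [P] conditioned on [A], relative to their law under [P]. *)
Lemma cond_probability_exists P A t : measurable A ->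
  exists q : t.-tuple X -> R, is_cond_probability P A q.
Proof.
move=> mA; have Afin : P A < +oo by rewrite ltey_eq fin_num_measure.
(* Normalizing by [P A] is impossible when it vanishes, but then the zero function is a version. *)
have [A0|A0] := eqVneq (P A) 0.
  exists (cst 0%R); apply: cond_probabilityP => // B mB; rewrite integral0.
  apply/esym/eqP; rewrite eq_le measure_ge0 andbT -A0.
  apply: le_measure; rewrite ?inE//; apply: measurableI => //; exact: measurable_cyl.
pose PA : probability _ R := mnormalize (mfrestr mA Afin) P.
have PAE B : PA B = P (B `&` A) * (fine (P A))^-1%:E.
  have restrT : mfrestr mA Afin setT = P A by rewrite /mfrestr /mrestr setTI.
  rewrite /PA /= /mnormalize; case: ifPn => [/orP[]/eqP H|_].
  - by move: A0 (etrans (esym restrT) H) => /eqP.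
  - by have := Afin; rewrite (etrans (esym restrT) H) ltxx.
  - by congr (_ * (fine _)^-1%:E).
have : history_law PA t `<< history_law P t.
  apply/null_content_dominatesP => B mB B0; rewrite history_lawE PAE.
  rewrite (_ : P _ = 0) ?mul0e//; apply/eqP; rewrite eq_le measure_ge0 andbT -[leRHS]B0.
  have mB' := measurable_cyl mB.
  by apply: le_measure; rewrite ?inE//; exact: measurableI.
move=> /radon_nikodym_sigma_finite[f [f0 ffin fint fE]].
have mf := measurable_int _ fint.
exists (fun h => fine (P A) * fine (f h))%R; apply: cond_probabilityP => //.
- by apply: measurable_funM => //; exact: measurableT_comp mf.
- by move=> h; rewrite mulr_ge0 ?fine_ge0.
move=> B mB; have mB' := measurable_cyl mB.
under eq_integral do rewrite EFinM !fineK// ?fin_num_measure//.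
rewrite ge0_integralZl//; last first.
  by apply: measurable_funTS; exact: measurableT_comp mf (@measurable_history _ _ t).
have := fE B mB; rewrite ge0_integral_pushforward//; last exact: measurable_funTS.
move=> <-; transitivity ((fine (P A))%:E * PA (cyl B)).
  by rewrite fineK// fin_num_measure.
have A0' : fine (P A) != 0%R by rewrite fine_eq0// fin_num_measure.
by rewrite PAE setIC muleCA -EFinM divff// mule1.
Qed.

Lemma ae_history P t (Q : t.-tuple X -> Prop) :
  (\forall h \ae history_law P t, Q h) -> \forall x \ae P, Q (history t x).
Proof.
move=> [N [mN N0 QN]]; exists (cyl N); split => //; first exact: measurable_cyl.
by move=> x /= Qx; apply: QN.
Qed.

(** From time [T] on the event is determined by the observations, so its indicator is itself a
    version, and versions agree almost surely. *)
Lemma cond_probability_full P T (G : set (T.-tuple X)) t (q : t.-tuple X -> R) :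
  measurable G -> (T <= t)%N -> is_cond_probability P (cyl G) q ->
  \forall x \ae P, q (history t x) = \1_(cyl G) x.
Proof.
move=> mG Tt cq; have [[mq _ qE] q0] := cq.
pose G' : set (t.-tuple X) := @prefix _ _ T t @^-1` G.
have mG' : measurable G' by exact: measurable_prefix_preimage.
have mG1 : measurable_fun setT (fun h => (\1_G' h)%:E : \bar R) by exact/measurable_EFinP.
have mq' : measurable_fun setT (EFin \o q) by exact/measurable_EFinP.
have : ae_eq (history_law P t) setT (EFin \o q) (fun h => (\1_G' h)%:E).
  apply: integral_ae_eq => //.
    apply/integrableP; split; first exact/measurable_EFinP.
    under eq_integral do rewrite gee0_abs ?lee_fin//.
    rewrite ge0_integral_pushforward//; last by move=> h _; rewrite lee_fin.
    rewrite [ltLHS](cond_probability_int (measurable_cyl mG) cq measurableT).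
    apply: (le_lt_trans (probability_le1 P _)); rewrite ?ltry//.
    by apply: measurableI; exact: measurable_cyl.
  move=> E _ mE.
  rewrite ge0_integral_pushforward//; last 2 first.
    exact: measurable_funTS.
    by move=> h _; rewrite lee_fin.
  rewrite [LHS](cond_probability_int (measurable_cyl mG) cq mE).
  by rewrite integral_indic// (cyl_prefix G Tt).
move=> H; have := ae_history H; apply: filterS => x /(_ I) [->].
by rewrite !indicE (cyl_prefix G Tt).
Qed.

End conditional_probabilities.

(** * The normalized conditional probability as martingale and e-process *)

Section conditional_e_process.
Context {R : realType} {d} {X : measurableType d}.
Variables (P : probability (pathspace X) R) (T : nat) (G : set (T.-tuple X)).
Hypotheses (mG : measurable G) (G0 : 0 < P (cyl G)).
Variable q : forall t, t.-tuple X -> R.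
Hypothesis qP : forall t, is_cond_probability P (cyl G) (@q t).

Let p := fine (P (cyl G)).
Let U t (h : t.-tuple X) : R := (q h / p)%R.

Let mA : measurable (cyl G). Proof. exact: measurable_cyl. Qed.

Let pE : P (cyl G) = p%:E. Proof. by rewrite /p fineK// fin_num_measure. Qed.

Let p0 : (0 < p)%R. Proof. by rewrite -lte_fin -pE. Qed.

Let mq t : measurable_fun setT (@q t). Proof. by have [[]] := qP t. Qed.

Let mU t : measurable_fun setT (@U t).
Proof. by apply: measurable_funM; [exact: mq|exact: measurable_cst]. Qed.

Let U0 t h : (0 <= @U t h)%R.
Proof. by have [_ q0] := qP t; rewrite mulr_ge0// invr_ge0 ltW. Qed.

Let int_U t (B : set (t.-tuple X)) : measurable B ->
  \int[P]_(x in cyl B) (@U t (history t x))%:E = (p^-1)%:E * P (cyl G `&` cyl B).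
Proof.
move=> mB; have [_ q0] := qP t.
under eq_integral do rewrite /U EFinM muleC.
rewrite ge0_integralZl//.
- by rewrite (cond_probability_int mA (qP t)).
- exact: measurable_cyl.
- by apply: measurable_funTS; exact: (measurable_process t mq).
- by move=> x _; rewrite lee_fin.
- by rewrite lee_fin invr_ge0 ltW.
Qed.

(** A cylinder over [t] observations is also one over [t + 1], and [int_U] gives the same integral
    over it at both times. *)
Lemma conditional_martingale : martingale P U.
Proof.
have iU t : P.-integrable setT (fun x => (@U t (history t x))%:E).
  apply/integrableP; split; first exact: measurable_process.
  under eq_integral do rewrite gee0_abs ?lee_fin//.
  have := int_U (measurableT : measurable (setT : set (t.-tuple X))).
  rewrite {1}/cyl preimage_setT => ->; rewrite [X in _ * P X](_ : _ = cyl G).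
    by rewrite pE -EFinM ltry.
  by rewrite {2}/cyl preimage_setT setIT.
split => // t; split => // B mB.
rewrite int_U// (cyl_prefix B (leqnSn t)) int_U//.
exact: measurable_prefix_preimage.
Qed.

(** Splitting by the value of [tau], each part, including the infinite one, contributes the mass of
    its intersection with [cyl G] divided by [p]; the total is exactly 1. *)
Lemma conditional_e_process : e_process P U.
Proof.
split => // tau st; have mp k := measurable_stop_part k st.
have ms : measurable_fun setT (stopped U tau) by exact: measurable_stopped.
rewrite -(stop_part_cover tau) ge0_integral_bigcup//; last 3 first.
- by rewrite stop_part_cover.
- by move=> x _; exact: stopped_ge0.
- exact: trivIset_stop_part.
have part k : \int[P]_(x in stop_part tau k) stopped U tau x =
    (p^-1)%:E * P (cyl G `&` stop_part tau k).
  case: k => [|n]; last first.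
    have [B mB E] := stop_partS n st; rewrite E -int_U// -E.
    by apply: eq_integral => x /set_mem /= tx; rewrite /stopped tx.
  transitivity (\int[P]_(x in stop_part tau 0) ((p^-1)%:E * (\1_(cyl G) x)%:E)).
    apply: ge0_ae_eq_integral => //.
    - exact: measurable_funTS.
    - apply: measurable_funTS; apply/measurable_EFinP; exact: measurable_funM.
    - by move=> x _; exact: stopped_ge0.
    - by move=> x _; rewrite -EFinM lee_fin mulr_ge0// invr_ge0 ltW.
    (* One null set serves all times [T + k], so almost surely the process is constant from [T] on
       and its upper limit is that constant. *)
    have := ae_foralln (fun k => cond_probability_full mG (leq_addr k T) (qP (T + k)%N)).
    apply: filterS => x qx /= tx; rewrite /stopped tx.
    apply: (cvg_limn_einf_sup _).2; apply: cvg_near_cst; near=> t.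
    have Tt : (T <= t)%N by near: t; exists T.
    by rewrite /U -(subnKC Tt) qx -EFinM mulrC.
  rewrite ge0_integralZl//.
  - by rewrite integral_indic.
  - exact/measurable_funTS/measurable_EFinP.
  - by rewrite lee_fin invr_ge0 ltW.
rewrite (eq_eseriesr (fun k _ => part k)) nneseriesZl//.
rewrite [X in _ * X](_ : _ = P (\bigcup_k (cyl G `&` stop_part tau k))).
  by rewrite -setI_bigcupr stop_part_cover setIT pE -EFinM mulVf ?gt_eqF.
rewrite measure_bigcup//.
- by apply: eq_eseriesl => k; rewrite in_setT.
- by move=> k _; exact: measurableI.
- by apply: trivIset_setIl; exact: trivIset_stop_part.
Unshelve. all: by end_near. Qed.

(** On [G], the value at time [T] is [1 / p], at least [1 / alpha], outside a [P]-null set. That set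
    depends on the first [T] observations only, so domination at horizon [T] makes it [P1]-null; the
    laws on infinite paths may well be mutually singular. *)
Lemma conditional_rejected (P1 : probability (pathspace X) R) (alpha : R) :
  history_law P1 T `<< history_law P T -> P (cyl G) <= alpha%:E ->
  P1 (cyl G) <= P1 (rejected_by alpha U T).
Proof.
move=> /null_content_dominatesP P10 Ga.
have ap : (p <= alpha)%R by rewrite -lee_fin -pE.
pose N := G `\` rejection_region alpha U T.
have mr : measurable (rejection_region alpha U T) by exact: measurable_rejection_region.
have mN : measurable N by exact: measurableD.
have N0 : P (cyl N) = 0.
  apply: measure_negligible; first exact: measurable_cyl.
  have := cond_probability_full mG (leqnn T) (qP T); apply: negligibleS => x [Gx Nx] /= qx.
  apply: Nx; exists T => //=; rewrite /preimage /= prefix_history// /U qx indicE mem_set// mul1r.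
  by rewrite lef_pV2 ?posrE//; exact: lt_le_trans ap.
have {}N0 : P1 (cyl N) = 0 by exact: P10.
rewrite rejected_byE -[leRHS]adde0 -N0 -measureU; last 3 first.
- exact: measurable_cyl.
- exact: measurable_cyl.
- by rewrite -subset0 => x [rx [_]].
apply: le_measure; rewrite ?inE//.
  by apply: measurableU; exact: measurable_cyl.
by move=> x Gx; have [?|?] := pselect (cyl (rejection_region alpha U T) x); [left|right].
Qed.

End conditional_e_process.

(** * Maximal power of e-processes and its attainment *)

Unset Implicit Arguments. Set Strict Implicit.

Theorem proposition2 (R : realType) (d : measure_display) (X : measurableType d)
    (hX : standard_borel R X) (alpha : R) (alpha01 : (0 < alpha < 1)%R)
    (pi0 pi1 : probability X R) (pi1_pi0 : pi1 `<< pi0)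
    (T : nat) (T_ge1 : (1 <= T)%N) :
  exists Gstar : set (T.-tuple X),
    [/\ measurable Gstar,
        iid_law pi0 (cyl Gstar) <= alpha%:E,
        ereal_sup [set iid_law pi1 (rejected_by alpha U T)
                  | U in e_process (iid_law pi0)] = iid_law pi1 (cyl Gstar),
        is_maximum [set iid_law pi1 (cyl G)
                   | G in [set G : set (T.-tuple X) |
                           measurable G /\ iid_law pi0 (cyl G) <= alpha%:E]]
          (iid_law pi1 (cyl Gstar)) &
        if 0 < iid_law pi0 (cyl Gstar) then
          (exists q : forall t, t.-tuple X -> R,
             forall t, is_cond_probability (iid_law pi0) (cyl Gstar) (q t)) /\
          forall q : forall t, t.-tuple X -> R,
            (forall t, is_cond_probability (iid_law pi0) (cyl Gstar) (q t)) ->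
            let Ustar t (h : t.-tuple X) :=
              (q t h / fine (iid_law pi0 (cyl Gstar)))%R in
            [/\ martingale (iid_law pi0) Ustar,
                e_process (iid_law pi0) Ustar &
                iid_law pi1 (rejected_by alpha Ustar T) =
                ereal_sup [set iid_law pi1 (rejected_by alpha U T)
                          | U in e_process (iid_law pi0)]]
        else
          let Uone t (h : t.-tuple X) : R := 1%R in
          e_process (iid_law pi0) Uone /\
          iid_law pi1 (rejected_by alpha Uone T) =
          ereal_sup [set iid_law pi1 (rejected_by alpha U T)
                    | U in e_process (iid_law pi0)]].
Proof.
have [a0 a1] := andP alpha01.
pose P0 := iid_law pi0; pose P1 := iid_law pi1.
have P10 : history_law P1 T `<< history_law P0 T.
  exact: history_law_dominates pi1_pi0 (iid_lawP pi0) (iid_lawP pi1).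
have [V sV mV] : exists2 V : nat -> set (T.-tuple X), separating V &
    forall m, measurable (V m).
  by have [U sU mU] := standard_borel_separating hX; exact: tuple_separating sU mU.
have [G [mG Ga Gopt]] := optimal_region_exists P10 sV mV (ltW a0).
have {}Ga : P0 (cyl G) <= alpha%:E.
  by rewrite -history_lawE (prE _ mG) lee_fin.
have {}Gopt (D : set (T.-tuple X)) :
    measurable D -> P0 (cyl D) <= alpha%:E -> P1 (cyl D) <= P1 (cyl G).
  move=> mD; rewrite -!history_lawE (prE _ mD) lee_fin => Da.
  by rewrite (prE _ mD) (prE _ mG) lee_fin; exact: Gopt.
have le_rej U : e_process P0 U -> P1 (rejected_by alpha U T) <= P1 (cyl G).
  move=> eU; rewrite rejected_byE; apply: Gopt.
    by apply: measurable_rejection_region; have [] := eU.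
  by rewrite -rejected_byE; exact: e_process_rejected.
(* A single e-process at least as powerful as [G] settles both the value of the supremum and its
   attainment; both cases of the conclusion supply one. *)
have supE U : e_process P0 U -> P1 (cyl G) <= P1 (rejected_by alpha U T) ->
    ereal_sup [set P1 (rejected_by alpha U T) | U in e_process P0] = P1 (cyl G) /\
    P1 (rejected_by alpha U T) =
    ereal_sup [set P1 (rejected_by alpha U T) | U in e_process P0].
  move=> eU GU; have -> : ereal_sup [set P1 (rejected_by alpha U T) | U in e_process P0] =
      P1 (cyl G).
    apply/eqP; rewrite eq_le; apply/andP; split.
      by apply: ge_ereal_sup => _ [U' eU' <-]; exact: le_rej.
    by apply: le_trans GU _; apply: ereal_sup_ubound; exists U.
  by split => //; apply/eqP; rewrite eq_le le_rej.
have maxG : is_maximum [set P1 (cyl G) | G in [set G : set (T.-tuple X) |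
    measurable G /\ P0 (cyl G) <= alpha%:E]] (P1 (cyl G)).
  by split; [exists G|move=> _ [D [mD Da] <-]; exact: Gopt].
exists G; case: ifPn => [G0|G0].
  have qex t := cid (@cond_probability_exists _ _ _ P0 _ t (measurable_cyl mG)).
  have Q q (qP : forall t, is_cond_probability P0 (cyl G) (q t)) :=
    supE _ (conditional_e_process mG G0 qP) (conditional_rejected mG G0 qP P10 Ga).
  split => //; first by have [] := Q _ (fun t => projT2 (qex t)).
  split; first by exists (fun t => projT1 (qex t)) => t; exact: projT2 (qex t).
  move=> q qP Ustar; split.
  - exact (conditional_martingale mG G0 qP).
  - exact (conditional_e_process mG G0 qP).
  - by have [] := Q q qP.
have {}G0 : P0 (cyl G) = 0.
  by apply/eqP; rewrite eq_le measure_ge0 andbT leNgt.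
have eone : e_process P0 (fun t (_ : t.-tuple X) => 1%R).
  split => // tau _; rewrite (eq_integral (cst 1)).
    by rewrite integral_cst// mul1e; exact: probability_le1.
  move=> x _; rewrite /stopped; case: (tau x) => //.
  exact: (cvg_limn_einf_sup (cvg_cst _)).2.
(* A [P0]-null optimal region is [P1]-null, so the best power is 0 and the constant process
   trivially reaches it. *)
have G1 : P1 (cyl G) = 0.
  by move/null_content_dominatesP : P10; apply.
have [S1 S2] := supE _ eone (eq_ind_r (fun z => z <= _) (measure_ge0 _ _) G1).
by split.
Qed.
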